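(* Let $\Gamma\subset SL_2(\mathbb R)$ be a lattice, $k\in\mathbb R$, $K\in\mathbb Z$, $n$ an integer with $0\le n<K/2$, and $a_0,\dots,a_n$ holomorphic functions on $\mathfrak H$, with $a_r:=0$ for $r>n$. For $0\le m\le n$ put $$h_m=\sum_{s\ge0}\binom{m+s}{s}\frac{(k+m)_s}{(K-2m-s-1)_s}\,D^s(a_{m+s}).$$ Then $L=\sum_{r=0}^n a_rD^r$ is a modular linear differential operator of type $(k,k+K)$ on $\Gamma$ if and only if $h_m\in M_{K-2m}(\Gamma)$ for all $0\le m\le n$. In that case $$L(f)=\sum_{m=0}^n\binom{K-m-1}{m}^{-1}[h_m,f]_m^{(K-2m,k)}.$$
   Context: A lattice is a discrete subgroup of $SL_2(\mathbb R)$ of finite covolume acting on the upper half-plane $\mathfrak H$. $(f|_k\gamma)(\tau)=(c\tau+d)^{-k}f(\gamma\tau)$; $D=\frac1{2\pi i}\frac d{d\tau}$; $(x)_s=x(x+1)\cdots(x+s-1)$. $M_w(\Gamma)$ is the space of holomorphic modular forms of weight $w$ on $\Gamma$. A modular linear differential operator of type $(k,k+K)$ on $\Gamma$ is a linear differential operator of finite order with coefficients holomorphic on $\mathfrak H$ (and at the cusps) such that $L(f|_k\gamma)=L(f)|_{k+K}\gamma$ for all holomorphic $f$ and $\gamma\in\Gamma$. Rankin–Cohen bracket: $[g,f]_m^{(\ell,k)}=\sum_{i=0}^m(-1)^i\binom{m+\ell-1}{m-i}\binom{m+k-1}{i}D^i(g)D^{m-i}(f)$. *)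

(* Defs.v *)
From HB Require Import structures.
From mathcomp Require Import all_boot all_order all_algebra.
From mathcomp Require Import all_classical all_reals all_analysis.
From mathcomp Require Import complex.

Set Implicit Arguments.
Unset Strict Implicit.
Unset Printing Implicit Defensive.

Import Order.TTheory GRing.Theory Num.Theory.
Import numFieldNormedType.Exports Normc.

Local Open Scope classical_set_scope.
Local Open Scope ring_scope.
Local Open Scope complex_scope.

Section HolomorphicFunctions.
Variable R : realType.
Implicit Types (z : R[i]) (f : R[i] -> R[i]).

(* [Re] and [Im] are qualified below because the unqualified names denote the
   [R[i]]-valued real and imaginary parts of a [numClosedFieldType].

   Functions on the upper half-plane are total functions [R[i] -> R[i]] whose
   values are only ever used at points [z] with [0 < Im z]. *)
Definition upper_half_plane : set R[i] := [set z | 0 < complex.Im z].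

Definition holomorphic f :=
  forall z, upper_half_plane z -> derivable (f : R[i]^o -> R[i]^o) z 1.

Definition D f : R[i] -> R[i] :=
  fun z => ('i * (2 * pi)%:C)^-1 * derive1 (f : R[i]^o -> R[i]^o) z.

(* Uniform in [Re z]; no periodicity is assumed. *)
Definition bounded_at_infty f :=
  exists Y B : R, forall z, Y < complex.Im z -> upper_half_plane z -> normc (f z) <= B.

Definition cexp z : R[i] := (expR (complex.Re z))%:C * (cos (complex.Im z) +i* sin (complex.Im z)).

(* Principal argument, in ]-pi, pi]. *)
Definition carg z : R :=
  if 0 <= complex.Im z then acos (complex.Re z / normc z) else - acos (complex.Re z / normc z).

Definition clog z : R[i] := ln (normc z) +i* carg z.

(* Principal branch of [z ^ s], meant for [z != 0]. *)
Definition cpow z (s : R) : R[i] := cexp (s%:C * clog z).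

End HolomorphicFunctions.

Section Slash.
Variable R : realType.
Implicit Types (z : R[i]) (f : R[i] -> R[i]) (g : 'M[R]_2).

Definition SL2 : set 'M[R]_2 := [set g | \det g = 1].

Definition autfactor g z : R[i] := (g 1 0)%:C * z + (g 1 1)%:C.

Definition moebius g z : R[i] :=
  ((g 0 0)%:C * z + (g 0 1)%:C) / autfactor g z.

(* For fixed [g] in [SL2] the factor [autfactor g z] stays in a single
   component of the complement of the real line, or is a nonzero real constant,
   so the principal branch is holomorphic in [z]. For integral [k] it is the
   usual power. *)
Definition slash (k : R) g f : R[i] -> R[i] :=
  fun z => cpow (autfactor g z) (- k) * f (moebius g z).

End Slash.

Section Lattices.
Variable R : realType.
Implicit Types (G : set 'M[R]_2) (F : set (R * R)).

Definition SL2_subgroup G :=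
  [/\ G `<=` @SL2 R, G 1%:M,
      forall g h, G g -> G h -> G (g *m h)
    & forall g, G g -> G (invmx g)].

Definition discrete G := G `<=` isolated G.

(* The point (x, y) of the plane stands for x + i y. *)
Definition hyperbolic_area F : \bar R :=
  (\int[(@lebesgue_measure R \x @lebesgue_measure R)%E]_(p in F)
     ((p.2 ^- 2)%:E))%E.

Definition moebius_image (g : 'M[R]_2) F : set (R * R) :=
  [set p | exists2 q, F q & moebius g (q.1 +i* q.2) = p.1 +i* p.2].

Definition fundamental_domain G F :=
  [/\ measurable F,
      F `<=` [set p | 0 < p.2],
      [set p | 0 < p.2] `<=` \bigcup_(g in G) moebius_image g F
    & forall g, G g -> g <> 1%:M -> g <> - 1%:M ->
        hyperbolic_area (F `&` moebius_image g F) = 0%E].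

Definition finite_covolume G :=
  exists2 F, fundamental_domain G F & (hyperbolic_area F < +oo)%E.

Definition lattice G := [/\ SL2_subgroup G, discrete G & finite_covolume G].

End Lattices.

Section ModularForms.
Variable R : realType.
Implicit Types (G : set 'M[R]_2) (g : 'M[R]_2) (f : R[i] -> R[i]).

Definition parabolic g :=
  [/\ g <> 1%:M, g <> - 1%:M & `|\tr g| = 2].

(* [s] maps the point at infinity to a cusp of [G], i.e. to the fixed point of a
   parabolic element of [G]. *)
Definition scales_cusp G (s : 'M[R]_2) :=
  SL2 s /\ exists g, [/\ G g, parabolic g & (invmx s *m g *m s) 1 0 = 0].

Definition holomorphic_at_cusps G (w : R) f :=
  forall s, scales_cusp G s -> bounded_at_infty (slash w s f).

Definition modular_form G (w : R) f :=
  [/\ holomorphic f,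
      forall g, G g -> forall z, upper_half_plane z -> slash w g f z = f z
    & holomorphic_at_cusps G w f].

End ModularForms.

Section DifferentialOperators.
Variable R : realType.
Implicit Types (G : set 'M[R]_2) (f h : R[i] -> R[i]) (a : nat -> R[i] -> R[i]).

(* The operator a_0 + a_1 D + ... + a_n D^n. *)
Definition diffop n a f : R[i] -> R[i] :=
  fun z => \sum_(r < n.+1) a r z * iter r (@D R) f z.

(* The coefficients of such an operator are not modular; the coefficient [a r]
   has weight [K - 2r] (as a quasimodular form), and this is the weight in which
   it is expanded at the cusps. Imposing boundedness for all [r] in these
   weights is equivalent to asking, for each [s] with [s oo] a cusp, that the
   operator [f |-> L (f |_k s^-1) |_(k+K) s] have coefficients that are bounded
   at infinity: the two families of coefficients differ by a unitriangular
   transformation with entries constant multiples of powers of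
   [c / (c z + d)]. *)
Definition mldo G (k : R) (K : int) n a :=
  [/\ forall r, (r <= n)%N -> holomorphic (a r),
      forall r, (r <= n)%N ->
        holomorphic_at_cusps G (K - r.*2%:Z)%:~R (a r)
    & forall g f, G g -> holomorphic f -> forall z, upper_half_plane z ->
        diffop n a (slash k g f) z = slash (k + K%:~R) g (diffop n a f) z].

Definition pochhammer (x : R) (s : nat) : R := \prod_(j < s) (x + j%:R).

Definition gbinom (x : R) (i : nat) : R :=
  (\prod_(j < i) (x - j%:R)) / i`!%:R.

Definition rankin_cohen (l k : R) m h f : R[i] -> R[i] :=
  fun z => \sum_(i < m.+1)
    ((-1) ^+ i * gbinom (m%:R + l - 1) (m - i)
               * gbinom (m%:R + k - 1) i)%:C
    * iter i (@D R) h z * iter (m - i) (@D R) f z.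

(* The sum stops at [m + s = n] since [a r] counts as 0 for [r > n]. *)
Definition mldo_h (k : R) (K : int) n a m : R[i] -> R[i] :=
  fun z => \sum_(s < (n - m).+1)
    ('C(m + s, s)%:R * pochhammer (k + m%:R) s
       / pochhammer (K - m.*2%:Z - s%:Z - 1)%:~R s)%:C
    * iter s (@D R) (a (m + s)%N) z.

End DifferentialOperators.

(* Main.v *)
Require Import Defs.
From HB Require Import structures.
From mathcomp Require Import all_boot all_order all_algebra.
From mathcomp Require Import all_classical all_reals all_analysis.
From mathcomp Require Import complex.
From mathcomp Require Import ring lra zify.

Set Implicit Arguments.
Unset Strict Implicit.
Unset Printing Implicit Defensive.

Import Order.TTheory GRing.Theory Num.Theory.
Import numFieldNormedType.Exports Normc.

Local Open Scope classical_set_scope.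
Local Open Scope ring_scope.
Local Open Scope complex_scope.

(** The formula for [L] and its covariance give both implications at once.

    The map from [(a_r)] to [(h_m)] is inverted by
    [a_r = \sum_(m >= r) a_coef K k m r * D^(m - r) h_m], which after cancelling the
    Pochhammer factors in [k] is a telescoping identity; this is the formula for
    [L f]. Rankin-Cohen brackets commute with the slash action of all of SL2(R):
    with [eps = - c / (2 pi i (c z + d))], which satisfies [D eps = eps^2],
      [D^n (f |_k g) = \sum_j 'C(n, j) (k + j)_(n - j) eps^(n - j) (D^j f)|_(k + 2j) g],
    and the terms with a positive power of [eps] cancel in the bracket by the
    binomial theorem for [(1 - 1)^N]. Hence
      [(L f)|_(k + K) g = \sum_m 'C(K - m - 1, m)^-1 [h_m|g, f|g]_m],
    so [L] is invariant if the [h_m] are; conversely, evaluating at [z] with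
    [f = (v - g z)^m] isolates [h_m] by descending induction on [m].

    At the cusps, [(D F)|_(w + 2) s = D (F|_w s) - w eps (F|_w s)], where [eps] is
    bounded at infinity and [D] preserves boundedness by Cauchy's estimate, so the
    [a_r] are bounded if and only if the [h_m] are.

    Holomorphy means mere complex differentiability here. Goursat's theorem, applied
    in the coordinate [zeta] to [(f (z + exp zeta) - f (z - exp zeta)) / (2 exp zeta)],
    expresses [f' z] as an integral over a circle; this yields Cauchy's estimate,
    then a local Lipschitz bound for [f'], then its differentiability. *)

(** In one variable over the field itself, derivability along 1 is differentiability, so the chain
    rule for differentials applies; linearity of the differential of [g] produces the product
    [l' * l]. *)
Lemma is_derive_comp_field (K : numFieldType) (f g : K^o -> K^o) (x : K^o) (l l' : K^o) :
  is_derive x (1 : K^o) f l -> is_derive (f x) (1 : K^o) g l' ->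
  is_derive x (1 : K^o) (g \o f) (l' * l).
Proof.
move=> [/derivable1_diffP df <-] [/derivable1_diffP dg <-].
have dc : differentiable (g \o f) x by exact: differentiable_comp.
split; first exact/derivable1_diffP.
rewrite -!derive1E derive1E'// diff_comp// !derive1E' //= -[X in 'd  _ _ X = _]mulr1.
by rewrite [LHS]linearZ mulrC.
Qed.

(** * The real-valued complex norm and complex differentiation *)

Section ComplexNorm.
Variable R : realType.
Implicit Types (x y z w l : R[i]) (f : R[i] -> R[i]).

Lemma normr_normc z : `|z| = (normc z)%:C.
Proof. by case: z => a b; rewrite normc_def. Qed.

Lemma normc_ge0 z : 0 <= normc z.
Proof. by case: z => a b; exact: sqrtr_ge0. Qed.

Lemma le_Re_normc z : `|complex.Re z| <= normc z.
Proof.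
by have := normc_ge_Re z; rewrite normr_normc lecR.
Qed.

Lemma le_Im_normc z : `|complex.Im z| <= normc z.
Proof.
case: z => a b /=; rewrite -sqrtr_sqr ler_sqrt ?addr_ge0 ?sqr_ge0//.
by rewrite lerDr sqr_ge0.
Qed.

Lemma normcR (a : R) : normc a%:C = `|a|.
Proof. by rewrite /= expr0n addr0 sqrtr_sqr. Qed.

Lemma normcI : normc ('i : R[i]) = 1.
Proof. by rewrite /= expr0n add0r expr1n sqrtr1. Qed.

Lemma normc_le_ReIm z : normc z <= `|complex.Re z| + `|complex.Im z|.
Proof.
rewrite {1}(complexE z); apply: le_trans (le_normcD _ _) _.
by rewrite normcM normcI mul1r !normcR.
Qed.

Lemma normcB z w : normc (z - w) = normc (w - z).
Proof. by rewrite -normcN opprB. Qed.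

Lemma normc_eq0 z : (normc z == 0) = (z == 0).
Proof.
by apply/eqP/eqP => [/eq0_normc//|->]; rewrite normc0.
Qed.

Lemma normc_gt0 z : (0 < normc z) = (z != 0).
Proof. by rewrite lt_neqAle normc_ge0 andbT eq_sym normc_eq0. Qed.

Lemma normc_le_sub z w : normc z <= normc w + normc (z - w).
Proof. by rewrite -[X in normc X <= _](subrK w) addrC le_normcD. Qed.

(** The scalars are [R[i]], so the derivative along 1 is the complex derivative, not a real partial
    one. *)
Definition hasD f z l := is_derive (z : R[i]^o) (1 : R[i]^o) (f : R[i]^o -> R[i]^o) l.

(** Radii in the topology of [R[i]^o] are elements of [R[i]]; a positive one is real and may be
    replaced by its real part. *)
Lemma nbhs_normc (z : R[i]) (P : set R[i]) :
  nbhs (z : R[i]^o) P <-> exists2 d, 0 < d & forall w, normc (w - z) < d -> P w.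
Proof.
split=> [/nbhs_ballP[e /= e0 He]|[d d0 Hd]].
  have eE : e = (complex.Re e)%:C by rewrite RRe_real // gtr0_real.
  exists (complex.Re e); first by rewrite eE ltcR in e0.
  by move=> w Hw; apply: He; rewrite -ball_normE /ball_ /= normr_normc normcB eE ltcR.
apply/nbhs_ballP; exists d%:C; rewrite /= ?ltcR// => w.
rewrite -ball_normE /ball_ /= normr_normc normcB ltcR; exact: Hd.
Qed.

(** Clearing the denominator of the difference quotient removes the exception at [w = z] and leaves
    only real constants; the estimates below work with this form. *)
Lemma hasDP f z l : hasD f z l <-> forall e, 0 < e ->
  exists2 d, 0 < d & forall w, normc (w - z) < d ->
    normc (f w - f z - l * (w - z)) <= e * normc (w - z).
Proof.
pose q (h : R[i]^o) : R[i]^o := h^-1 *: (f (h *: (1 : R[i]^o) + z) - f z).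
have key : hasD f z l <-> q @ (0 : R[i]^o)^' --> (l : R[i]^o).
  split=> [H|H]; first by case: H => Hf <-; exact: Hf.
  by split; [apply/cvg_ex; exists l | exact: cvg_lim].
have qE h : q h = h^-1 * (f (h + z) - f z) by rewrite /q /GRing.scale /= mulr1.
have cvq := @cvgrPdist_le R[i] R[i]^o _ _ (dnbhs_filter (0 : R[i]^o)) q l.
split=> [/key/cvq H e e0|H]; last (apply/key/cvq => e e0).
  have /H : 0 < e%:C by rewrite ltcR.
  rewrite near_withinE => /nbhs_normc[d d0 Hd]; exists d => // w wz.
  have [->|wzN] := eqVneq w z; first by rewrite !subrr mulr0 subr0 normc0 mulr0.
  have := Hd (w - z); rewrite subr0 subr_eq0 => /(_ wz wzN).
  rewrite normr_normc lecR qE subrK => Hq.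
  have -> : f w - f z - l * (w - z) = - ((w - z) * (l - (w - z)^-1 * (f w - f z))).
    by field; rewrite subr_eq0.
  by rewrite normcN normcM mulrC ler_wpM2r// normc_ge0.
have eE : e = (complex.Re e)%:C by rewrite RRe_real // gtr0_real.
have /H[d d0 Hd] : 0 < complex.Re e by rewrite eE ltcR in e0.
rewrite near_withinE; apply/nbhs_normc; exists d => // h; rewrite subr0 => hd hN0.
have := Hd (h + z); rewrite addrK => /(_ hd) Hf.
rewrite normr_normc eE lecR qE.
have hp : 0 < normc h by rewrite normc_gt0.
rewrite -(ler_pM2r hp) -normcM; apply: le_trans Hf.
rewrite -normcN le_eqVlt; apply/orP; left; apply/eqP; congr normc.
by field.
Qed.

Lemma hasD_continuous f z l : hasD f z l -> forall e, 0 < e ->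
  exists2 d, 0 < d & forall w, normc (w - z) < d -> normc (f w - f z) < e.
Proof.
move=> /hasDP /(_ 1 ltr01)[d d0 Hd] e e0.
have L0 : 0 < 1 + normc l + 1 by have := normc_ge0 l; lra.
exists (Num.min d (e / (1 + normc l + 1))); first by rewrite lt_min d0 divr_gt0.
move=> w; rewrite lt_min => /andP[wd we].
have -> : f w - f z = (f w - f z - l * (w - z)) + l * (w - z) by rewrite subrK.
apply: le_lt_trans (le_normcD _ _) _; rewrite normcM.
have := Hd _ wd; move: we; rewrite ltr_pdivlMr//.
have := normc_ge0 (w - z); have := normc_ge0 l; nra.
Qed.

Lemma hasD_eq f z l l' : hasD f z l -> l = l' -> hasD f z l'.
Proof. by move=> H <-. Qed.

Lemma hasD_near f g z l d : 0 < d -> (forall w, normc (w - z) < d -> f w = g w) ->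
  hasD f z l -> hasD g z l.
Proof.
move=> d0 fg; apply: near_eq_is_derive.
by apply/nbhs_normc; exists d.
Qed.

Lemma hasD_cst (c : R[i]) z : hasD (fun=> c) z 0.
Proof. exact: is_derive_cst. Qed.

Lemma hasD_id z : hasD id z 1.
Proof. exact: is_derive_id. Qed.

Lemma hasDD f g z l l' : hasD f z l -> hasD g z l' ->
  hasD (fun w => f w + g w) z (l + l').
Proof. exact: is_deriveD. Qed.

Lemma hasDB f g z l l' : hasD f z l -> hasD g z l' ->
  hasD (fun w => f w - g w) z (l - l').
Proof. exact: is_deriveB. Qed.

Lemma hasDM f g z l l' : hasD f z l -> hasD g z l' ->
  hasD (fun w => f w * g w) z (f z * l' + g z * l).
Proof. exact: is_deriveM. Qed.

Lemma hasDZ f z l c : hasD f z l -> hasD (fun w => c * f w) z (c * l).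
Proof. by move=> /(hasDM (hasD_cst c z)) /hasD_eq; apply; rewrite mulr0 addr0. Qed.

Lemma hasDV f z l : f z != 0 -> hasD f z l -> hasD (fun w => (f w)^-1) z (- (f z) ^- 2 * l).
Proof.
by move=> fz [H <-]; split; [exact: derivableV | rewrite deriveV].
Qed.

Lemma hasD_comp f g z l l' : hasD f z l -> hasD g (f z) l' ->
  hasD (fun w => g (f w)) z (l' * l).
Proof. exact: is_derive_comp_field. Qed.

Lemma hasD_sum (I : Type) (r : seq I) (f : I -> R[i] -> R[i]) z (l : I -> R[i]) :
  (forall i, hasD (f i) z (l i)) ->
  hasD (fun w => \sum_(i <- r) f i w) z (\sum_(i <- r) l i).
Proof.
move=> H; elim: r => [|i r IH].
  rewrite big_nil; under eq_fun do rewrite big_nil; exact: hasD_cst.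
rewrite big_cons; under eq_fun do rewrite big_cons; exact: hasDD.
Qed.

Lemma hasDX f z l n : hasD f z l ->
  hasD (fun w => f w ^+ n.+1) z (n.+1%:R * f z ^+ n * l).
Proof.
move=> H; elim: n => [|n IH].
  by move: H => /hasD_eq; apply; rewrite expr0 !mul1r.
under eq_fun do rewrite exprS.
apply: hasD_eq (hasDM H IH) _.
by rewrite (_ : n.+2%:R = n.+1%:R + 1) ?natr1// !exprS; ring.
Qed.

End ComplexNorm.

(** * Goursat's theorem *)

Section ComplexIntegral.
Variable R : realType.
Implicit Types (a b m : R) (u v : R -> R[i]) (c : R[i]).

Definition ccont u := forall x e, 0 < e ->
  exists2 d, 0 < d & forall y, `|y - x| < d -> normc (u y - u x) < e.

Lemma ccont_Re u : ccont u -> continuous (@complex.Re R \o u).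
Proof.
move=> cu x; apply/cvgrPdist_lt => e e0; have [d d0 Hd] := cu x e e0.
apply/nbhs_ballP; exists d => //= y; rewrite /ball /= distrC => /Hd.
by rewrite normcB; apply: le_lt_trans; rewrite -raddfB le_Re_normc.
Qed.

Lemma ccont_Im u : ccont u -> continuous (@complex.Im R \o u).
Proof.
move=> cu x; apply/cvgrPdist_lt => e e0; have [d d0 Hd] := cu x e e0.
apply/nbhs_ballP; exists d => //= y; rewrite /ball /= distrC => /Hd.
by rewrite normcB; apply: le_lt_trans; rewrite -raddfB le_Im_normc.
Qed.

Lemma ccont_cst c : ccont (fun=> c).
Proof. by move=> x e e0; exists 1 => // y _; rewrite subrr normc0. Qed.

Lemma ccontB u v : ccont u -> ccont v -> ccont (fun t => u t - v t).
Proof.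
move=> cu cv x e e0; have e2 : 0 < e / 2 by lra.
have [d d0 Hd] := cu x _ e2; have [d' d'0 Hd'] := cv x _ e2.
exists (Num.min d d'); first by rewrite lt_min d0.
move=> y; rewrite lt_min => /andP[/Hd h1 /Hd' h2].
have -> : u y - v y - (u x - v x) = (u y - u x) + - (v y - v x) by ring.
by apply: le_lt_trans (le_normcD _ _) _; rewrite normcN; lra.
Qed.

Lemma ccontZ c u : ccont u -> ccont (fun t => c * u t).
Proof.
move=> cu x e e0; have nc := normc_ge0 c; have c0 : 0 < 1 + normc c by lra.
have [d d0 Hd] := cu x (e / (1 + normc c)) (divr_gt0 e0 c0).
exists d => // y /Hd; rewrite -mulrBr normcM ltr_pdivlMr//.
by have := normc_ge0 (u y - u x); nra.
Qed.

Definition rintegral a b (u : R -> R) : R := (\int[@lebesgue_measure R]_(t in `[a, b]) u t)%R.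

Lemma continuous_integrable a b (u : R -> R) : continuous u ->
  (@lebesgue_measure R).-integrable `[a, b] (EFin \o u).
Proof.
move=> cu; apply: continuous_compact_integrable; first exact: segment_compact.
exact: continuous_subspaceT.
Qed.

Lemma rintegralB a b (u v : R -> R) : continuous u -> continuous v ->
  rintegral a b (fun t => u t - v t) = rintegral a b u - rintegral a b v.
Proof. by move=> cu cv; apply: RintegralB => //; exact: continuous_integrable. Qed.

Lemma rintegralD a b (u v : R -> R) : continuous u -> continuous v ->
  rintegral a b (fun t => u t + v t) = rintegral a b u + rintegral a b v.
Proof. by move=> cu cv; apply: RintegralD => //; exact: continuous_integrable. Qed.

Lemma rintegralZ a b (r : R) (u : R -> R) : continuous u ->
  rintegral a b (fun t => r * u t) = r * rintegral a b u.
Proof. by move=> cu; apply: RintegralZl => //; exact: continuous_integrable. Qed.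

Lemma rintegral_cst a b (r : R) : a <= b -> rintegral a b (fun=> r) = r * (b - a).
Proof.
move=> ab; have E : @lebesgue_measure R `[a, b]%classic = (b - a)%:E.
  rewrite lebesgue_measure_itv /= lte_fin.
  by have [->|neq_ab] := eqVneq a b; rewrite ?ltxx ?subrr// lt_neqAle neq_ab ab.
by rewrite /rintegral Rintegral_cst//; congr (r * _); rewrite -[RHS]/(fine (b - a)%:E) -E.
Qed.

Lemma rintegral_bound a b (M : R) (u : R -> R) : a <= b -> continuous u ->
  (forall t, a <= t <= b -> `|u t| <= M) -> `|rintegral a b u| <= M * (b - a).
Proof.
move=> ab cu uM; have iu := continuous_integrable a b cu.
rewrite -rintegral_cst//; apply: le_trans (le_normr_Rintegral _ iu) _ => //.
apply: le_Rintegral => //.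
- apply: (@continuous_integrable a b (fun t => `|u t|)).
  by move=> x; apply: cvg_norm; exact: cu.
- by apply: continuous_integrable => x; exact: cvg_cst.
Qed.

Lemma rintegral_split a m b (u : R -> R) : a <= m -> m <= b -> continuous u ->
  rintegral a b u = rintegral a m u + rintegral m b u.
Proof.
move=> am mb cu; have iu := continuous_integrable a b cu.
have := @Rintegral_itvB R u (BLeft a) (BRight b) m iu.
rewrite !bnd_simp => /(_ am mb) /eqP; rewrite subr_eq => /eqP.
have im : (@lebesgue_measure R).-integrable `]m, b] (EFin \o u).
  apply: integrableS iu => //; apply: subset_itvr; by rewrite bnd_simp.
by rewrite Rintegral_itv_obnd_cbnd// => H; rewrite /rintegral H addrC.
Qed.

Definition cintegral a b u : R[i] := rintegral a b (@complex.Re R \o u) +i* rintegral a b (@complex.Im R \o u).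

Lemma eq_cintegral a b u v : (forall t, a <= t <= b -> u t = v t) -> cintegral a b u = cintegral a b v.
Proof.
move=> uv; rewrite /cintegral /rintegral; congr (_ +i* _); apply: eq_Rintegral => t;
  by rewrite inE /= in_itv /= => /uv ->.
Qed.

Lemma cintegralB a b u v : ccont u -> ccont v ->
  cintegral a b (fun t => u t - v t) = cintegral a b u - cintegral a b v.
Proof.
move=> cu cv; rewrite /cintegral.
have -> : @complex.Re R \o (fun t => u t - v t) = (fun t => (@complex.Re R \o u) t - (@complex.Re R \o v) t).
  by apply/funext => t /=; rewrite raddfB.
have -> : @complex.Im R \o (fun t => u t - v t) = (fun t => (@complex.Im R \o u) t - (@complex.Im R \o v) t).
  by apply/funext => t /=; rewrite raddfB.
by rewrite !rintegralB//; [exact: ccont_Im|exact: ccont_Im|exact: ccont_Re|exact: ccont_Re].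
Qed.

Lemma cintegralZ a b c u : ccont u -> cintegral a b (fun t => c * u t) = c * cintegral a b u.
Proof.
move=> cu; rewrite /cintegral; have cR := ccont_Re cu; have cI := ccont_Im cu.
have cZ (r : R) (w : R -> R) : continuous w -> continuous (fun t => r * w t).
  by move=> cw x; apply: cvgM; [exact: cvg_cst | exact: cw].
case: c => r s.
have -> : @complex.Re R \o (fun t => (r +i* s) * u t) =
    (fun t => r * (@complex.Re R \o u) t - s * (@complex.Im R \o u) t).
  by apply/funext => t /=; case: (u t).
have -> : @complex.Im R \o (fun t => (r +i* s) * u t) =
    (fun t => r * (@complex.Im R \o u) t + s * (@complex.Re R \o u) t).
  by apply/funext => t /=; case: (u t).
by rewrite rintegralB ?rintegralD ?rintegralZ//; exact: cZ.
Qed.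

Lemma cintegral_cst a b c : a <= b -> cintegral a b (fun=> c) = c * (b - a)%:C.
Proof.
move=> ab; rewrite /cintegral.
rewrite (_ : @complex.Re R \o _ = fun=> complex.Re c)// (_ : @complex.Im R \o _ = fun=> complex.Im c)//.
by rewrite !rintegral_cst//; case: c => r s; simpc.
Qed.

(** Real and imaginary parts are bounded separately, which costs the factor 2. *)
Lemma cintegral_bound a b (M : R) u : a <= b -> ccont u ->
  (forall t, a <= t <= b -> normc (u t) <= M) -> normc (cintegral a b u) <= 2 * M * (b - a).
Proof.
move=> ab cu uM; apply: le_trans (normc_le_ReIm _) _ => /=.
have h1 : `|rintegral a b (@complex.Re R \o u)| <= M * (b - a).
  apply: rintegral_bound => //; first exact: ccont_Re.
  by move=> t /uM; apply: le_trans; exact: le_Re_normc.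
have h2 : `|rintegral a b (@complex.Im R \o u)| <= M * (b - a).
  apply: rintegral_bound => //; first exact: ccont_Im.
  by move=> t /uM; apply: le_trans; exact: le_Im_normc.
by lra.
Qed.

Lemma cintegral_split a m b u : a <= m -> m <= b -> ccont u -> cintegral a b u = cintegral a m u + cintegral m b u.
Proof.
move=> am mb cu; rewrite /cintegral (rintegral_split am mb (ccont_Re cu)) (rintegral_split am mb (ccont_Im cu)).
by simpc.
Qed.

End ComplexIntegral.

(** * Bisection and Goursat's theorem on rectangles *)

Section Goursat.
Variable R : realType.
Implicit Types (x y w h t s : R) (g : R[i] -> R[i]).

(** Compactness as an induction principle: [P x y t] speaks of the rectangle with corner [(x, y)]
    and sides [w t], [h t]. If it failed at size 1, successive failing quarters would shrink to a
    point [(p, q)], against the local hypothesis there. With [h = 0] it is bisection of a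
    segment. *)
Lemma bisection w h (P : R -> R -> R -> Prop) x y : 0 <= w -> 0 <= h ->
  (forall x y t, 0 < t -> P x y (t / 2) -> P (x + w * (t / 2)) y (t / 2) ->
     P x (y + h * (t / 2)) (t / 2) ->
     P (x + w * (t / 2)) (y + h * (t / 2)) (t / 2) -> P x y t) ->
  (forall p q, x <= p <= x + w -> y <= q <= y + h -> exists2 d, 0 < d &
     forall x' y' t, 0 < t < d -> x <= x' -> x' + w * t <= x + w ->
       y <= y' -> y' + h * t <= y + h -> x' <= p <= x' + w * t ->
       y' <= q <= y' + h * t -> P x' y' t) ->
  P x y 1.
Proof.
move=> w0 h0 Psplit Ploc; apply: contrapT => NP.
pose T := (R * R * R)%type.
(* Failure of [P] and positivity of the size are premises inside the relation, which makes it total,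
   as dependent choice demands. *)
pose rel (s s' : T) := ~ P s.1.1 s.1.2 s.2 -> 0 < s.2 ->
  [/\ ~ P s'.1.1 s'.1.2 s'.2, s'.2 = s.2 / 2,
      s'.1.1 = s.1.1 \/ s'.1.1 = s.1.1 + w * (s.2 / 2)
    & s'.1.2 = s.1.2 \/ s'.1.2 = s.1.2 + h * (s.2 / 2)].
have relP (s : T) : {s' : T | rel s s'}.
  apply: cid; case: s => -[a b] t; rewrite /rel /=.
  have [Pab|NPab] := pselect (P a b t); first by exists (a, b, t).
  have [t0|t0] := boolP (0 < t); last by exists (a, b, t).
  have [P1|P1] := pselect (P a b (t / 2)); last first.
    by exists (a, b, t / 2) => _ _ /=; split => //; left.
  have [P2|P2] := pselect (P (a + w * (t / 2)) b (t / 2)); last first.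
    by exists (a + w * (t / 2), b, t / 2) => _ _ /=; split => //; [right|left].
  have [P3|P3] := pselect (P a (b + h * (t / 2)) (t / 2)); last first.
    by exists (a, b + h * (t / 2), t / 2) => _ _ /=; split => //; [left|right].
  have [P4|P4] := pselect (P (a + w * (t / 2)) (b + h * (t / 2)) (t / 2)); last first.
    by exists (a + w * (t / 2), b + h * (t / 2), t / 2) => _ _ /=; split => //; right.
  by case: NPab; exact: Psplit.
have [f [f0 fS]] := dependent_choice relP (x, y, 1).
have inv n : ~ P (f n).1.1 (f n).1.2 (f n).2 /\ 0 < (f n).2.
  elim: n => [|n [NPn tn]]; first by rewrite f0.
  by have [NPS tE _ _] := fS n NPn tn; split => //; rewrite tE divr_gt0.
have fS' n := let: conj a b := inv n in fS n a b.
pose X n := (f n).1.1; pose Y n := (f n).1.2; pose t n := (f n).2.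
have t0 n : 0 < t n by have [] := inv n.
have tS n : t n.+1 = t n / 2 by have [] := fS' n.
(* Treats both coordinates at once: left ends increase, right ends decrease, and the supremum of the
   left ends lies in every interval. *)
have mono (Z : nat -> R) (v : R) : 0 <= v ->
    (forall n, Z n.+1 = Z n \/ Z n.+1 = Z n + v * (t n / 2)) ->
    exists p, forall n, Z n <= p <= Z n + v * t n.
  move=> v0 ZS.
  have step n : Z n <= Z n.+1 /\ Z n.+1 + v * t n.+1 <= Z n + v * t n.
    by rewrite tS; have := t0 n; case: (ZS n) => -> tn; split; nra.
  have up n k : Z n <= Z (n + k)%N /\ Z (n + k)%N + v * t (n + k)%N <= Z n + v * t n.
    elim: k => [|k IH]; first by rewrite addn0.
    by rewrite addnS; have := step (n + k)%N; lra.
  have ub n m : Z m <= Z n + v * t n.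
    have [nm|mn] := leqP n m.
      have := up n (m - n)%N; rewrite subnKC// => -[_].
      by have := t0 m; nra.
    have := up m (n - m)%N; rewrite subnKC// ?(ltnW mn)// => -[? _].
    by have := t0 n; nra.
  exists (sup (range Z)) => n; apply/andP; split.
    apply: ub_le_sup; last by exists n.
    by exists (Z 0%N + v * t 0%N) => _ [m _ <-]; exact: ub.
  apply: ge_sup; first by exists (Z 0%N), 0%N.
  by move=> _ [m _ <-]; exact: ub.
have [|p Hp] := mono X w w0; first by move=> n; have [] := fS' n.
have [|q Hq] := mono Y h h0; first by move=> n; have [] := fS' n.
have X0 : X 0%N = x by rewrite /X f0.
have Y0 : Y 0%N = y by rewrite /Y f0.
have T0 : t 0%N = 1 by rewrite /t f0.
have Xin n : x <= X n /\ X n + w * t n <= x + w.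
  elim: n => [|n [IH1 IH2]]; first by rewrite X0 T0 mulr1.
  have [_ _ + _] := fS' n; rewrite -/(X n.+1) -/(X n) -/(t n) tS.
  by have tn := t0 n; case => ->; split; nra.
have Yin n : y <= Y n /\ Y n + h * t n <= y + h.
  elim: n => [|n [IH1 IH2]]; first by rewrite Y0 T0 mulr1.
  have [_ _ _ +] := fS' n; rewrite -/(Y n.+1) -/(Y n) -/(t n) tS.
  by have tn := t0 n; case => ->; split; nra.
have := Hp 0%N; rewrite X0 T0 mulr1 => px.
have := Hq 0%N; rewrite Y0 T0 mulr1 => qy.
have [d d0 Hd] := Ploc p q px qy.
have tE n : t n * 2 ^+ n = 1.
  elim: n => [|n IH]; first by rewrite T0 expr0 mulr1.
  by rewrite tS exprS -[RHS]IH; field.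
(* The sizes are [2^-n], and [2^N > N > d^-1] for a suitable [N]. *)
have [n tn] : exists n, t n < d.
  have [N HN] : exists N : nat, d^-1 < N%:R.
    by exists (Num.bound d^-1); apply: archi_boundP; rewrite invr_ge0 ltW.
  exists N; rewrite ltNge; apply/negP => dt.
  have h2 : N%:R < 2 ^+ N :> R by rewrite -natrX ltr_nat ltn_expl.
  have h3 : d * d^-1 = 1 by rewrite divff// gt_eqF.
  have := tE N; have d1 : 0 < d^-1 by rewrite invr_gt0.
  by nra.
have [NPn _] := inv n; apply: NPn.
by apply: Hd; [rewrite t0 | have [] := Xin n | have [] := Xin n | have [] := Yin n
  | have [] := Yin n | exact: Hp | exact: Hq].
Qed.

Definition gcont g := forall z e, 0 < e ->
  exists2 d, 0 < d & forall v, normc (v - z) < d -> normc (g v - g z) < e.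

Lemma gcont_horiz g y : gcont g -> ccont (fun s => g (s +i* y)).
Proof.
move=> cg x e /(cg (x +i* y))[d d0 Hd]; exists d => // s sx; apply: Hd.
have -> : (s +i* y) - (x +i* y) = (s - x)%:C.
  by apply/eqP; rewrite eq_complex /= subrr !eqxx.
by rewrite normcR.
Qed.

Lemma gcont_vert g x : gcont g -> ccont (fun s => g (x +i* s)).
Proof.
move=> cg y e /(cg (x +i* y))[d d0 Hd]; exists d => // s sy; apply: Hd.
have -> : (x +i* s) - (x +i* y) = 'i * (s - y)%:C.
  by apply/eqP; rewrite eq_complex /= subrr; apply/andP; split; apply/eqP; ring.
by rewrite normcM normcI mul1r normcR.
Qed.

(* Counterclockwise along the boundary of [x, x + w] x [y, y + h]. *)
Definition rect_integral g x y w h : R[i] :=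
  cintegral x (x + w) (fun s => g (s +i* y)) - cintegral x (x + w) (fun s => g (s +i* (y + h)))
  + 'i * (cintegral y (y + h) (fun s => g ((x + w) +i* s)) - cintegral y (y + h) (fun s => g (x +i* s))).

Lemma rect_integral_split_w g x y w1 w2 h : gcont g -> 0 <= w1 -> 0 <= w2 ->
  rect_integral g x y (w1 + w2) h = rect_integral g x y w1 h + rect_integral g (x + w1) y w2 h.
Proof.
move=> cg w10 w20; have l1 : x <= x + w1 by lra.
have l2 : x + w1 <= x + (w1 + w2) by lra.
rewrite /rect_integral (cintegral_split l1 l2 (gcont_horiz y cg)) (cintegral_split l1 l2 (gcont_horiz (y + h) cg)).
by rewrite !addrA; ring.
Qed.

Lemma rect_integral_split_h g x y w h1 h2 : gcont g -> 0 <= h1 -> 0 <= h2 ->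
  rect_integral g x y w (h1 + h2) = rect_integral g x y w h1 + rect_integral g x (y + h1) w h2.
Proof.
move=> cg h10 h20; have l1 : y <= y + h1 by lra.
have l2 : y + h1 <= y + (h1 + h2) by lra.
rewrite /rect_integral (cintegral_split l1 l2 (gcont_vert x cg)) (cintegral_split l1 l2 (gcont_vert (x + w) cg)).
by rewrite !addrA; ring.
Qed.

(* Affine functions contribute constants to the integrals of differences over
   opposite sides, and these constants cancel. *)
Lemma rect_integral_affine_bound g x y w h (A l : R[i]) (E : R) : gcont g -> 0 <= w -> 0 <= h ->
  (forall s t, x <= s <= x + w -> y <= t <= y + h ->
     normc (g (s +i* t) - (A + l * (s +i* t))) <= E) ->
  normc (rect_integral g x y w h) <= 4 * E * (w + h).
Proof.
move=> cg w0 h0 HE.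
have xw : x <= x + w by lra.
have yh : y <= y + h by lra.
have xx : x <= x <= x + w by rewrite lexx.
have yy : y <= y <= y + h by rewrite lexx.
have xx' : x <= x + w <= x + w by rewrite lexx andbT.
have yy' : y <= y + h <= y + h by rewrite lexx andbT.
pose u s := g (s +i* y) - g (s +i* (y + h)) - - (l * 'i * h%:C).
pose v s := g ((x + w) +i* s) - g (x +i* s) - l * w%:C.
have cH t := gcont_horiz t cg; have cV t := gcont_vert t cg.
have cu : ccont u by apply: ccontB; [exact: ccontB | exact: ccont_cst].
have cv : ccont v by apply: ccontB; [exact: ccontB | exact: ccont_cst].
have -> : rect_integral g x y w h = cintegral x (x + w) u + 'i * cintegral y (y + h) v.
  rewrite /rect_integral /u /v !cintegralB//; try exact: ccont_cst; try exact: ccontB.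
  rewrite !cintegral_cst// [x + w]addrC [y + h]addrC !addrK; ring.
have bu : normc (cintegral x (x + w) u) <= 2 * (E + E) * (x + w - x).
  apply: cintegral_bound => // s xs.
  have := HE s y xs yy; have := HE s (y + h) xs yy'.
  set P := g _ - _; set Q := g (s +i* y) - _ => hP hQ.
  have -> : u s = Q - P.
    rewrite /u /P /Q (_ : s +i* (y + h) = (s +i* y) + 'i * h%:C); last by simpc.
    ring.
  by apply: le_trans (le_normcD _ _) _; rewrite normcN; lra.
have bv : normc (cintegral y (y + h) v) <= 2 * (E + E) * (y + h - y).
  apply: cintegral_bound => // s ys.
  have := HE x s xx ys; have := HE (x + w) s xx' ys.
  set P := g _ - _; set Q := g (x +i* s) - _ => hP hQ.
  have -> : v s = P - Q.
    rewrite /v /P /Q (_ : (x + w) +i* s = (x +i* s) + w%:C); last by simpc.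
    ring.
  by apply: le_trans (le_normcD _ _) _; rewrite normcN; lra.
apply: le_trans (le_normcD _ _) _; rewrite normcM normcI mul1r; lra.
Qed.

(** The bound [e t^2] for the integral over a rectangle of scale [t] is additive over quarters,
    since [4 (t/2)^2 = t^2], and holds locally because [g] is affine up to a small error.
    Differentiability is asked relative to the closed rectangle, so that [g] may be a merely
    continuous extension outside it. *)
Lemma goursat g x y w h : gcont g -> 0 < w -> 0 < h ->
  (forall s t, x <= s <= x + w -> y <= t <= y + h -> exists l, forall e, 0 < e ->
     exists2 d, 0 < d & forall s' t', x <= s' <= x + w -> y <= t' <= y + h ->
       normc ((s' +i* t') - (s +i* t)) < d ->
       normc (g (s' +i* t') - g (s +i* t) - l * ((s' +i* t') - (s +i* t)))
         <= e * normc ((s' +i* t') - (s +i* t))) ->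
  rect_integral g x y w h = 0.
Proof.
move=> cg w0 h0 dg; apply/eqP; rewrite -normc_eq0 eq_le normc_ge0 andbT.
apply/ler_addgt0Pl => e e0; rewrite addr0.
pose P x y t : Prop := normc (rect_integral g x y (w * t) (h * t)) <= e * t ^+ 2.
suff : P x y 1 by rewrite /P !mulr1 expr1n mulr1.
apply: (bisection (ltW w0) (ltW h0)) => [x' y' t t0|p q px qy]; last first.
  have [l Hl] := dg p q px qy.
  (* Chosen so that the affine bound [4 (e/k) ((w + h) t)^2] is exactly [e t^2]. *)
  pose k := 4 * (w + h) ^+ 2; have k0 : 0 < k by rewrite /k mulr_gt0// exprn_gt0// addr_gt0.
  have [d d0 Hd] := Hl (e / k) (divr_gt0 e0 k0).
  exists (d / (w + h)); first by rewrite divr_gt0// addr_gt0.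
  move=> x' y' t /andP[t0 td] xx' xw' yy' yh' xp yq; rewrite /P.
  have wt : 0 < w * t by rewrite mulr_gt0.
  have ht : 0 < h * t by rewrite mulr_gt0.
  have td' : w * t + h * t < d by rewrite ltr_pdivlMr ?addr_gt0// in td; lra.
  have := @rect_integral_affine_bound g x' y' (w * t) (h * t) (g (p +i* q) - l * (p +i* q)) l
    (e / k * (w * t + h * t)) cg (ltW wt) (ltW ht).
  have -> : 4 * (e / k * (w * t + h * t)) * (w * t + h * t) = e * t ^+ 2.
    rewrite /k; field; rewrite gt_eqF// addr_gt0//.
  apply => s r sx ry.
  have nn : normc ((s +i* r) - (p +i* q)) <= w * t + h * t.
    apply: le_trans (normc_le_ReIm _) _ => /=.
    by apply: lerD; rewrite ler_norml; lra.
  have -> : g (s +i* r) - (g (p +i* q) - l * (p +i* q) + l * (s +i* r)) =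
     g (s +i* r) - g (p +i* q) - l * ((s +i* r) - (p +i* q)) by ring.
  apply: le_trans (Hd s r _ _ _) _; [lra|lra|lra|].
  by apply: ler_wpM2l => //; rewrite ltW// divr_gt0.
rewrite /P => P1 P2 P3 P4.
have tw : w * t = w * (t / 2) + w * (t / 2) by lra.
have th : h * t = h * (t / 2) + h * (t / 2) by lra.
have w20 : 0 <= w * (t / 2) by rewrite mulr_ge0 ?ltW// divr_gt0.
have h20 : 0 <= h * (t / 2) by rewrite mulr_ge0 ?ltW// divr_gt0.
rewrite tw th rect_integral_split_w// !rect_integral_split_h//.
apply: le_trans (le_normcD _ _) _.
have := le_normcD (rect_integral g x' y' (w * (t / 2)) (h * (t / 2)))
  (rect_integral g x' (y' + h * (t / 2)) (w * (t / 2)) (h * (t / 2))).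
have := le_normcD (rect_integral g (x' + w * (t / 2)) y' (w * (t / 2)) (h * (t / 2)))
  (rect_integral g (x' + w * (t / 2)) (y' + h * (t / 2)) (w * (t / 2)) (h * (t / 2))).
have : e * t ^+ 2 = 4 * (e * (t / 2) ^+ 2) by field.
lra.
Qed.

End Goursat.

(** * Cauchy's estimate and the holomorphy of derivatives *)

Section ComplexExponential.
Variable R : realType.
Implicit Types (z w : R[i]) (u v : R -> R[i]).

Lemma is_deriveP_real (f : R -> R) (x l : R) : is_derive x 1 f l -> forall e, 0 < e ->
  exists2 d, 0 < d & forall y, `|y - x| < d -> `|f y - f x - l * (y - x)| <= e * `|y - x|.
Proof.
move=> [df <-] e e0.
have := @cvgrPdist_le R R^o _ _ (dnbhs_filter (0 : R^o)) (fun h => h^-1 *: (f (h *: (1 : R^o) + x) - f x)) ('D_1 f x).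
move=> [] /(_ df) /(_ e e0).
rewrite near_withinE => /nbhs_ballP[d /= d0 Hd] _; exists d => // y yx.
have [->|yN] := eqVneq y x; first by rewrite !subrr mulr0 subr0 normr0 mulr0.
have yx0 : y - x != 0 by rewrite subr_eq0.
have := Hd (y - x); rewrite /ball /= sub0r normrN => /(_ yx yx0).
rewrite /GRing.scale /= mulr1 subrK => H.
have -> : f y - f x - 'D_1 f x * (y - x) = - ((y - x) * ('D_1 f x - (y - x)^-1 * (f y - f x))).
  by field.
by rewrite normrN normrM mulrC ler_wpM2r.
Qed.

Lemma cexpD z w : cexp (z + w) = cexp z * cexp w.
Proof.
case: z => a b; case: w => c d; rewrite /cexp /= expRD cosD sinD.
by apply/eqP; rewrite eq_complex /=; apply/andP; split; apply/eqP; ring.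
Qed.

Lemma cexp0 : cexp (0 : R[i]) = 1.
Proof. by rewrite /cexp /= expR0 cos0 sin0; simpc. Qed.

Lemma normc_cexp z : normc (cexp z) = expR (complex.Re z).
Proof.
rewrite /cexp normcM normcR ger0_norm ?expR_ge0//= cos2Dsin2 sqrtr1 mulr1//.
Qed.

Lemma cexp_neq0 z : cexp z != 0.
Proof. by rewrite -normc_gt0 normc_cexp expR_gt0. Qed.

Lemma cexpN z : cexp (- z) = (cexp z)^-1.
Proof.
by apply: (mulfI (cexp_neq0 z)); rewrite -cexpD subrr cexp0 divff ?cexp_neq0.
Qed.

Lemma cexp_half_period z : cexp (z + 'i * pi%:C) = - cexp z.
Proof.
rewrite cexpD (_ : cexp ('i * pi%:C) = -1) ?mulrN1//.
have -> : 'i * pi%:C = 0 +i* pi :> R[i] by simpc.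
by rewrite /cexp /= expR0 cospi sinpi; simpc.
Qed.

Lemma hasD_cexp0 : hasD (@cexp R) 0 1.
Proof.
(* The errors below add up to at most 9 times [e1] times the norm, which explains the 10; [e1 <= 1]
   keeps [expR a] at most 3. *)
apply/hasDP => e e0; pose e1 := Num.min (e / 10) 1.
have e10 : 0 < e1 by rewrite lt_min ltr01 divr_gt0.
have e1e : 10 * e1 <= e.
  have : e1 <= e / 10 by rewrite /e1 ge_min lexx.
  lra.
have e11 : e1 <= 1 by rewrite /e1 ge_min lexx orbT.
clearbody e1.
have [d1 d10 H1] := is_deriveP_real (is_derive_expR (0 : R)) e10.
have [d2 d20 H2] := is_deriveP_real (is_derive_cos (0 : R)) e10.
have [d3 d30 H3] := is_deriveP_real (is_derive_sin (0 : R)) e10.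
pose d := Num.min (Num.min d1 e1) (Num.min d2 d3).
have d0 : 0 < d by rewrite /d !lt_min d10 d20 d30 e10.
exists d => // -[a b]; rewrite subr0 cexp0 mul1r => hd.
have ha : `|a| <= normc (a +i* b) := le_Re_normc (a +i* b).
have hb : `|b| <= normc (a +i* b) := le_Im_normc (a +i* b).
have : normc (a +i* b) < Num.min (Num.min d1 e1) (Num.min d2 d3) by [].
rewrite !lt_min => /andP[/andP[n1 n2] /andP[n3 n4]].
have := H1 a; have := H2 b; have := H3 b; rewrite !subr0 expR0 cos0 sin0 oppr0.
rewrite mul0r !mul1r !subr0 addr0.
move=> /(_ (le_lt_trans hb n4)) h3 /(_ (le_lt_trans hb n3)) h2 /(_ (le_lt_trans ha n1)) h1.
have a1 : `|a| < e1 by apply: le_lt_trans n2.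
have aa := normr_ge0 a; have bb := normr_ge0 b.
have k1 : `|expR a - 1| <= 2 * `|a|.
  have -> : expR a - 1 = (expR a - 1 - a) + a by ring.
  by apply: le_trans (ler_normD _ _) _; nra.
have k2 : `|expR a| <= 3.
  have -> : expR a = (expR a - 1) + 1 by ring.
  by apply: le_trans (ler_normD _ _) _; rewrite normr1; nra.
apply: le_trans (normc_le_ReIm _) _.
have -> : complex.Re (cexp (a +i* b) - 1 - (a +i* b)) =
    expR a * (cos b - 1) + (expR a - 1 - a).
  by rewrite /cexp /=; ring.
have -> : complex.Im (cexp (a +i* b) - 1 - (a +i* b)) =
    expR a * (sin b - b) + b * (expR a - 1).
  by rewrite /cexp /=; ring.
have l1 : `|expR a * (cos b - 1) + (expR a - 1 - a)| <= 3 * (e1 * `|b|) + e1 * `|a|.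
  apply: le_trans (ler_normD _ _) _; apply: lerD => //.
  by rewrite normrM; apply: ler_pM.
have l2 : `|expR a * (sin b - b) + b * (expR a - 1)| <= 3 * (e1 * `|b|) + `|b| * (2 * e1).
  apply: le_trans (ler_normD _ _) _; apply: lerD => //; rewrite normrM; apply: ler_pM => //.
  by lra.
have m1 : e1 * `|b| <= e1 * normc (a +i* b) by rewrite ler_pM2l.
have m2 : e1 * `|a| <= e1 * normc (a +i* b) by rewrite ler_pM2l.
have m3 : 10 * e1 * normc (a +i* b) <= e * normc (a +i* b).
  by rewrite ler_wpM2r// normc_ge0.
have m4 := mulr_ge0 (ltW e10) (normc_ge0 (a +i* b)).
lra.
Qed.

Lemma hasD_cexp z : hasD (@cexp R) z (cexp z).
Proof.
have E : @cexp R = fun w => cexp z * cexp (w - z).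
  by apply/funext => w; rewrite -cexpD subrKC.
rewrite {1}E; apply: hasD_eq (_ : hasD _ z (cexp z * (1 * (1 - 0)))) _; last first.
  by rewrite subr0 !mulr1.
apply: hasDZ; apply: (@hasD_comp _ (fun w => w - z) (@cexp R)).
  by apply: hasDB; [exact: hasD_id | exact: hasD_cst].
by rewrite subrr; exact: hasD_cexp0.
Qed.

Lemma ccontM u v : ccont u -> ccont v -> ccont (fun t => u t * v t).
Proof.
move=> cu cv x e e0.
have nu := normc_ge0 (u x); have nv := normc_ge0 (v x).
pose k := 2 + normc (u x) + normc (v x); have k0 : 0 < k by rewrite /k; lra.
pose e1 := Num.min 1 (e / k).
have e10 : 0 < e1 by rewrite lt_min ltr01 divr_gt0.
have e11 : e1 <= 1 by rewrite /e1 ge_min lexx.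
have e1k : e1 * k <= e by rewrite -ler_pdivlMr// /e1 ge_min lexx orbT.
have [d d0 Hd] := cu x e1 e10; have [d' d'0 Hd'] := cv x e1 e10.
exists (Num.min d d'); first by rewrite lt_min d0.
move=> y; rewrite lt_min => /andP[/Hd h1 /Hd' h2].
have -> : u y * v y - u x * v x =
  (u y - u x) * (v y - v x) + (u x * (v y - v x) + v x * (u y - u x)) by ring.
apply: le_lt_trans (le_normcD _ _) _.
apply: le_lt_trans (lerD (lexx _) (le_normcD _ _)) _; rewrite !normcM.
have := normc_ge0 (u y - u x); have := normc_ge0 (v y - v x).
move: e1k h1 h2; rewrite /k; nra.
Qed.

Lemma ccont_comp (f : R[i] -> R[i]) u : ccont u ->
  (forall t e, 0 < e -> exists2 d, 0 < d & forall w, normc (w - u t) < d -> normc (f w - f (u t)) < e) ->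
  ccont (fun t => f (u t)).
Proof.
move=> cu cf x e e0; have [d d0 Hd] := cf x e e0; have [d' d'0 Hd'] := cu x d d0.
by exists d' => // y /Hd' /Hd.
Qed.

Lemma gcont_hasD (f : R[i] -> R[i]) : (forall z, exists l, hasD f z l) -> gcont f.
Proof. by move=> df z e e0; have [l /hasD_continuous] := df z; apply. Qed.

(** Bisection of the segment from [z] to [w]: the bound [(M |w - z| + e) t] for the increment over a
    parameter interval of length [t] is additive, and differentiability gives it locally. *)
Lemma mean_value_ineq (f : R[i] -> R[i]) z w (M : R) :
  (forall t : R, 0 <= t <= 1 -> exists2 l, hasD f (z + t%:C * (w - z)) l & normc l <= M) ->
  normc (f w - f z) <= M * normc (w - z).
Proof.
move=> df; apply/ler_addgt0Pl => e e0.
pose phi (t : R) := f (z + t%:C * (w - z)).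
pose P (x y t : R) : Prop := normc (phi (x + 1 * t) - phi x) <= (M * normc (w - z) + e) * t.
suff : P 0 0 1.
  rewrite /P /phi !mulr1 add0r mul1r mul0r addr0 subrKC.
  by rewrite [_ + e]addrC.
apply: (@bisection R 1 0) => // [x y t t0|p q p01 _].
  rewrite /P !mul1r => h1 h2 _ _.
  have -> : phi (x + t) - phi x = (phi (x + t / 2 + t / 2) - phi (x + t / 2)) + (phi (x + t / 2) - phi x).
    have -> : x + t / 2 + t / 2 = x + t by field.
    ring.
  by apply: le_trans (le_normcD _ _) _; lra.
have p1 : 0 <= p <= 1 by lra.
have [l /hasDP dl lM] := df p p1.
have nwz := normc_ge0 (w - z).
have k0 : 0 < 1 + normc (w - z) by lra.
have [d d0 Hd] := dl (e / (1 + normc (w - z))) (divr_gt0 e0 k0).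
exists (d / (1 + normc (w - z))); first by rewrite divr_gt0.
move=> x y t /andP[t0]; rewrite ltr_pdivlMr// => td _ _ _ _; rewrite mul1r => xp _.
have est s : `|s - p| <= t -> normc (phi s - phi p) <= (M * normc (w - z) + e) * `|s - p|.
  move=> sp; have E : (z + s%:C * (w - z)) - (z + p%:C * (w - z)) = (s - p)%:C * (w - z).
    by rewrite rmorphB /=; ring.
  have nE : normc ((z + s%:C * (w - z)) - (z + p%:C * (w - z))) = `|s - p| * normc (w - z).
    by rewrite E normcM normcR.
  have sp0 := normr_ge0 (s - p).
  have := Hd (z + s%:C * (w - z)); rewrite nE => /(_ _) H.
  have /H{}H : `|s - p| * normc (w - z) < d by nra.
  rewrite -/(phi s) -/(phi p) in H.
  have -> : phi s - phi p = (phi s - phi p - l * (z + s%:C * (w - z) - (z + p%:C * (w - z))))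
     + l * (z + s%:C * (w - z) - (z + p%:C * (w - z))) by rewrite subrK.
  apply: le_trans (le_normcD _ _) _; rewrite normcM nE.
  have h1 : e / (1 + normc (w - z)) * (`|s - p| * normc (w - z)) <= e * `|s - p|.
    have -> : e * `|s - p| = e / (1 + normc (w - z)) * (`|s - p| * (1 + normc (w - z))).
      by field; rewrite gt_eqF.
    by rewrite ler_pM2l ?divr_gt0// ler_wpM2l//; lra.
  have h2 : normc l * (`|s - p| * normc (w - z)) <= M * (`|s - p| * normc (w - z)).
    by rewrite ler_wpM2r// mulr_ge0.
  by lra.
rewrite /P mul1r.
(* Since [x <= p <= x + t], the distances from [p] to the two ends add up to [t], so comparing both
   ends with [p] loses nothing. *)
have -> : phi (x + t) - phi x = (phi (x + t) - phi p) - (phi x - phi p) by ring.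
apply: le_trans (le_normcD _ _) _; rewrite normcN.
have a1 : `|x + t - p| = x + t - p by rewrite ger0_norm//; lra.
have a2 : `|x - p| = p - x by rewrite ler0_norm; lra.
have := est (x + t); have := est x; rewrite a1 a2.
by move=> /(_ ltac:(lra)) h1 /(_ ltac:(lra)) h2; lra.
Qed.

End ComplexExponential.

(** * Cauchy's formula for the derivative and its consequences *)

Section Cauchy.
Variable R : realType.
Implicit Types (f : R[i] -> R[i]) (z w l c : R[i]) (x r rho : R).

Lemma normc_Re_mono (a a' b : R) : `|a| <= `|a'| -> normc (a +i* b) <= normc (a' +i* b).
Proof.
move=> aa; rewrite /= ler_sqrt ?addr_ge0 ?sqr_ge0// lerD2r.
by rewrite -[a ^+ 2]real_normK ?num_real// -[a' ^+ 2]real_normK ?num_real// ler_pXn2r ?nnegrE.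
Qed.

(** It is even in [c], so its mean over a half circle is its mean over the full circle. That mean is
    the Cauchy integral of [f w / (w - z)^2], divided by [2 pi i]. *)
Definition symdq f z c : R[i] := (f (z + c) - f (z - c)) * (2 * c)^-1.

(** Here [x] is the logarithm of the radius and [s] the angle. *)
Let circ x (s : R) : R[i] := cexp (x +i* s).

Lemma normc_circ x s : normc (circ x s) = expR x.
Proof. by rewrite normc_cexp. Qed.

Lemma ccont_circ x : ccont (circ x).
Proof. by apply: (@gcont_vert R (@cexp R)); apply: gcont_hasD => z; exists (cexp z); exact: hasD_cexp. Qed.

Lemma ccont_circV x : ccont (fun s => (2 * circ x s)^-1).
Proof.
move=> y e e0; have E s : (2 * circ x s)^-1 = 2^-1 * cexp (- (x +i* s)) by rewrite invfM cexpN.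
have cN : ccont (fun s => 2^-1 * cexp (- x +i* (- s))).
  apply: ccontZ => {}y {}e {}e0; have [d d0 Hd] := @ccont_circ (- x) (- y) e e0.
  by exists d => // s sy; apply: Hd; rewrite -opprD normrN.
have [d d0 Hd] := cN y e e0; exists d => // s /Hd.
by rewrite !E /GRing.opp /=.
Qed.

Lemma ccont_symdq f z x :
  (forall w, normc (w - z) = expR x -> forall e, 0 < e ->
     exists2 d, 0 < d & forall v, normc (v - w) < d -> normc (f v - f w) < e) ->
  ccont (fun s => symdq f z (circ x s)).
Proof.
move=> cf; apply: ccontM; last exact: ccont_circV.
apply: ccontB.
  apply: (@ccont_comp R f (fun s => z + circ x s)) => [y e e0|t]; last first.
    by apply: cf; rewrite addrC addKr normc_circ.
  have [d d0 Hd] := @ccont_circ x y e e0; exists d => // s /Hd.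
  by rewrite opprD addrACA subrr add0r.
apply: (@ccont_comp R f (fun s => z - circ x s)) => [y e e0|t]; last first.
  by apply: cf; rewrite addrC addKr normcN normc_circ.
have [d d0 Hd] := @ccont_circ x y e e0; exists d => // s /Hd.
have -> : z - circ x s - (z - circ x y) = - (circ x s - circ x y) by ring.
by rewrite normcN.
Qed.

(* With [w = exp zeta] the symmetric difference quotient becomes a function of
   [zeta] of period [i pi], so that in Goursat's theorem on a rectangle of
   height [pi] the horizontal sides cancel, and the integral over the vertical
   side does not depend on its abscissa [x]. Let [x] tend to minus infinity. *)
Lemma cintegral_symdq_indep f z rho x1 x2 : x1 < x2 -> expR x2 < rho ->
  (forall w, normc (w - z) < rho -> exists l, hasD f w l) ->
  cintegral 0 pi (fun s => symdq f z (circ x1 s)) = cintegral 0 pi (fun s => symdq f z (circ x2 s)).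
Proof.
move=> x12 x2rho df.
pose F zeta := symdq f z (cexp zeta).
have rho0 : 0 < rho by apply: lt_trans x2rho; exact: expR_gt0.
have dF zeta : expR (complex.Re zeta) < rho -> exists l, hasD F zeta l.
  move=> zr; rewrite /F /symdq.
  have [l1 h1] : exists l, hasD f (z + cexp zeta) l.
    by apply: df; rewrite addrC addKr normc_cexp.
  have [l2 h2] : exists l, hasD f (z - cexp zeta) l.
    by apply: df; rewrite addrC addKr normcN normc_cexp.
  have hc := hasD_cexp zeta.
  have k1 := hasD_comp (hasDD (hasD_cst z zeta) hc) h1.
  have k2 := hasD_comp (hasDB (hasD_cst z zeta) hc) h2.
  have k3 : 2 * cexp zeta != 0 by rewrite mulf_neq0 ?cexp_neq0// pnatr_eq0.
  have k4 := hasDV (f := fun w => 2 * cexp w) k3 (hasDZ 2 hc).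
  by have := hasDM (hasDB k1 k2) k4; eexists; eassumption.
(* [goursat] wants continuity on the whole plane, while [F] is controlled only where
   [expR (Re zeta) < rho]. Composition with this 1-Lipschitz projection onto [Re zeta <= x2] extends
   [F] continuously from the rectangle. *)
pose clamp zeta : R[i] := Num.min (complex.Re zeta) x2 +i* complex.Im zeta.
have clampL v zeta : normc (clamp v - clamp zeta) <= normc (v - zeta).
  case: v => a b; case: zeta => a' b'; rewrite /clamp /=.
  apply: (@normc_Re_mono (Num.min a x2 - Num.min a' x2) (a - a') (b - b')).
  case: (ltP a x2) => h1; case: (ltP a' x2) => h2.
  - by [].
  - by rewrite !ler0_norm; lra.
  - by rewrite !ger0_norm; lra.
  - by rewrite subrr normr0.
have clampE s t : s <= x2 -> clamp (s +i* t) = s +i* t.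
  by move=> sx; rewrite /clamp /= min_l.
pose g zeta := F (clamp zeta).
have cg : gcont g.
  move=> zeta e e0; have [|l dl] := dF (clamp zeta).
    apply: le_lt_trans x2rho; rewrite ler_expR /clamp /=.
    by rewrite ge_min lexx orbT.
  have [d d0 Hd] := hasD_continuous dl e0; exists d => // v vz; apply: Hd.
  exact: le_lt_trans (clampL _ _) vz.
have w0 : 0 < x2 - x1 by rewrite subr_gt0.
have := goursat (x := x1) (y := 0) cg w0 (pi_gt0 R).
rewrite /rect_integral !subrKC !add0r => H.
have : forall s t : R, x1 <= s <= x2 -> 0 <= t <= pi -> exists l : R[i], forall e : R, 0 < e ->
   exists2 d : R, 0 < d & forall s' t' : R, x1 <= s' <= x2 -> 0 <= t' <= pi ->
     normc (s' +i* t' - s +i* t) < d ->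
     normc (g (s' +i* t') - g (s +i* t) - l * (s' +i* t' - s +i* t)) <=
       e * normc (s' +i* t' - s +i* t).
  move=> s t /andP[s1 s2] _; have [|l /hasDP dl] := dF (s +i* t).
    by apply: le_lt_trans x2rho; rewrite ler_expR.
  exists l => e /dl[d d0 Hd]; exists d => // s' t' /andP[_ s'2] _ /Hd.
  by rewrite /g !clampE.
move=> /H{H}.
have -> : cintegral x1 x2 (fun s => g (s +i* pi)) = cintegral x1 x2 (fun s => g (s +i* 0)).
  apply: eq_cintegral => s /andP[_ s2]; rewrite /g !clampE// /F.
  have -> : s +i* pi = (s +i* 0) + 'i * pi%:C by simpc.
  by rewrite cexp_half_period /symdq opprK mulrN invrN mulrN -mulNr opprB.
have i0 : ('i : R[i]) != 0 by rewrite -normc_gt0 normcI.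
rewrite subrr add0r => /eqP; rewrite mulf_eq0 (negbTE i0) /=.
rewrite subr_eq0 => /eqP H; transitivity (cintegral 0 pi (fun s => g (x1 +i* s))).
  by apply: eq_cintegral => s _; rewrite /g clampE ?ltW.
by rewrite -H; apply: eq_cintegral => s _; rewrite /g clampE.
Qed.

Lemma normc2 : normc (2 : R[i]) = 2.
Proof. by rewrite -(rmorph_nat (real_complex R)) normcR ger0_norm. Qed.

Lemma symdq_near f z l : hasD f z l -> forall e, 0 < e ->
  exists2 d, 0 < d & forall c, c != 0 -> normc c < d -> normc (symdq f z c - l) <= e.
Proof.
move=> /hasDP df e /df[d d0 Hd]; exists d => // c c0 cd.
have := Hd (z + c); have := Hd (z - c).
rewrite ![_ - z]addrC !addKr normcN => /(_ cd) h1 /(_ cd) h2.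
have c2 : 2 * c != 0 by rewrite mulf_neq0// pnatr_eq0.
have -> : symdq f z c - l =
    ((f (z + c) - f z - l * c) - (f (z - c) - f z - l * - c)) * (2 * c)^-1.
  by rewrite /symdq; field.
rewrite normcM normcV ler_pdivrMr ?normc_gt0//.
apply: le_trans (le_normcD _ _) _; rewrite normcN normcM normc2.
by lra.
Qed.

Lemma expR_small (e : R) : 0 < e -> exists x, expR x < e.
Proof.
move=> e0; exists (ln (e / 2)); rewrite lnK ?posrE ?divr_gt0//; lra.
Qed.

(** Cauchy's formula for the derivative, folded onto a half circle: the integral does not depend on
    the radius, and on small circles the integrand is uniformly close to [l]. *)
Lemma cauchy_formula f z rho l x : expR x < rho ->
  (forall w, normc (w - z) < rho -> exists l, hasD f w l) -> hasD f z l ->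
  cintegral 0 pi (fun s => symdq f z (circ x s)) = l * pi%:C.
Proof.
move=> xrho df dz; have p0 := pi_gt0 R; have p0' := pi_ge0 R.
have sc y : expR y < rho -> ccont (fun s => symdq f z (circ y s)).
  move=> yr; apply: ccont_symdq => w wz.
  by have [|m] := df w; rewrite ?wz// => /hasD_continuous.
apply/eqP; rewrite -subr_eq0 -normc_eq0 eq_le normc_ge0 andbT.
apply/ler_addgt0Pl => e e0; rewrite addr0.
(* The 2 compensates the factor in [cintegral_bound], and [pi] is the length of the interval. *)
have e20 : 0 < e / (2 * pi) by rewrite divr_gt0// mulr_gt0.
have [d d0 Hd] := symdq_near dz e20.
have [y0 Hy0] := expR_small d0.
(* Small enough for the approximation by [l], and strictly below [x] as the comparison of radii
   requires. *)
pose y := Num.min y0 (x - 1).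
have yx : y < x by rewrite /y gt_min; apply/orP; right; lra.
have yd : expR y < d by apply: le_lt_trans Hy0; rewrite ler_expR /y ge_min lexx.
have yr : expR y < rho by apply: lt_trans xrho; rewrite ltr_expR.
rewrite -(cintegral_symdq_indep yx xrho df).
have -> : cintegral 0 pi (fun s => symdq f z (circ y s)) - l * pi%:C =
    cintegral 0 pi (fun s => symdq f z (circ y s) - l).
  by rewrite cintegralB ?cintegral_cst ?subr0//; [exact: sc | exact: ccont_cst].
apply: le_trans (cintegral_bound (M := e / (2 * pi)) p0' _ _) _.
- by apply: ccontB; [exact: sc | exact: ccont_cst].
- by move=> s _; apply: Hd; rewrite ?cexp_neq0// normc_circ.
- by rewrite subr0 mulrAC mulrCA divff ?mulr1// gt_eqF// mulr_gt0.
Qed.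

Lemma cauchy_estimate f z rho r (M : R) l : 0 < r < rho ->
  (forall w, normc (w - z) < rho -> exists l, hasD f w l) -> hasD f z l ->
  (forall w, normc (w - z) = r -> normc (f w) <= M) ->
  normc l <= 2 * M / r.
Proof.
move=> /andP[r0 rrho] df dz fM; have p0 := pi_gt0 R.
have rE : expR (ln r) = r by rewrite lnK.
have xr : expR (ln r) < rho by rewrite rE.
have H := cauchy_formula xr df dz.
have : normc (l * pi%:C) <= 2 * (M / r) * (pi - 0).
  rewrite -H; apply: cintegral_bound; first exact: pi_ge0.
    apply: ccont_symdq => w wz.
    by have [|m] := df w; rewrite ?wz ?rE// => /hasD_continuous.
  move=> s _; rewrite /symdq normcM normcV normcM normc2 normc_circ rE.
  rewrite ler_pdivrMr ?mulr_gt0//.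
  have -> : M / r * (2 * r) = M + M by field; rewrite gt_eqF.
  apply: le_trans (le_normcD _ _) _; rewrite normcN; apply: lerD; apply: fM.
    by rewrite addrC addKr normc_circ.
  by rewrite addrC addKr normcN normc_circ.
rewrite normcM normcR subr0 gtr0_norm// ler_pM2r//.
by rewrite mulrA.
Qed.

Lemma hasD_shift f z c l : hasD f (z + c) l -> hasD (fun w => f (w + c)) z l.
Proof.
move=> df; have := hasD_comp (hasDD (hasD_id z) (hasD_cst c z)) df.
by rewrite addr0 mulr1.
Qed.

(** Near [z], [f1] is a Cauchy integral of [f] over a circle of fixed radius [r], and a difference
    may be taken under the integral. Bounds are bootstrapped for this: [f] bounded, hence [f1]
    bounded, hence [f] Lipschitz, hence [f1] Lipschitz, hence a first-order expansion of [f] with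
    quadratic error. *)
Lemma hasD_derivative f (f1 : R[i] -> R[i]) z rho : 0 < rho ->
  (forall w, normc (w - z) < rho -> hasD f w (f1 w)) -> exists l, hasD f1 z l.
Proof.
move=> rho0 df0.
have [d d0 Hd] : exists2 d, 0 < d & forall w, normc (w - z) < d -> normc (f w - f z) < 1.
  by apply: hasD_continuous (df0 z _) _ ltr01; rewrite subrr normc0.
(* An eighth leaves room for the nested discs of radii [8 r], [6 r], [3 r] and [2 r] on which the
   successive bounds hold. *)
pose r := Num.min rho d / 8; pose M := 1 + normc (f z).
have r0 : 0 < r by rewrite divr_gt0// lt_min rho0.
have r8 : 8 * r = Num.min rho d by rewrite /r; field.
clearbody r.
have df w : normc (w - z) < 8 * r -> hasD f w (f1 w).
  by rewrite r8 lt_min => /andP[/df0].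
have fM w : normc (w - z) < 8 * r -> normc (f w) <= M.
  rewrite r8 lt_min => /andP[_ /Hd]; have := normc_le_sub (f w) (f z); rewrite /M; lra.
have tri u v w : normc (u - w) <= normc (u - v) + normc (v - w).
  by rewrite -[u - w](subrKA v) le_normcD.
have M0 : 0 <= M by rewrite /M addr_ge0// normc_ge0.
pose M1 := 2 * M / r.
have M10 : 0 <= M1 by rewrite !mulr_ge0// invr_ge0 ltW.
have f1M w : normc (w - z) < 6 * r -> normc (f1 w) <= M1.
  move=> wz; apply: (@cauchy_estimate f w (2 * r)).
  - by rewrite r0 ltr_pMl// ltr1n.
  - by move=> v vw; exists (f1 v); apply: df; have := tri v w z; lra.
  - by apply: df; lra.
  - by move=> v vw; apply: fM; have := tri v w z; lra.
have conv u v t k : normc (u - z) < k -> normc (v - z) < k -> 0 <= t <= 1 ->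
    normc (u + t%:C * (v - u) - z) < k.
  move=> uk vk /andP[t0 t1].
  have -> : u + t%:C * (v - u) - z = (1 - t)%:C * (u - z) + t%:C * (v - z).
    by rewrite rmorphB /= rmorph1; ring.
  apply: le_lt_trans (le_normcD _ _) _; rewrite !normcM !normcR !ger0_norm ?subr_ge0//.
  have := mulr_ge0 t0 (ltW (_ : 0 < k - normc (v - z))); rewrite subr_gt0 => /(_ vk) h1.
  have [t1'|t1'] := ltP t 1; last by have -> : t = 1; lra.
  have : 0 < (1 - t) * (k - normc (u - z)) by rewrite mulr_gt0// subr_gt0.
  lra.
have fL u v : normc (u - z) < 6 * r -> normc (v - z) < 6 * r ->
    normc (f v - f u) <= M1 * normc (v - u).
  move=> uz vz; apply: mean_value_ineq => t t01.
  exists (f1 (u + t%:C * (v - u))); last by apply: f1M; exact: conv.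
  by apply: df; have := conv u v t _ uz vz t01; lra.
pose M2 := 2 * M1 / r.
have f1L u v : normc (u - z) < 3 * r -> normc (v - z) < 3 * r ->
    normc (f1 v - f1 u) <= M2 * normc (v - u).
  move=> uz vz; have -> : M2 * normc (v - u) = 2 * (M1 * normc (v - u)) / r.
    by rewrite /M2; ring.
  (* The derivative of [q] at [u] is [f1 v - f1 u], and [fL] bounds [q] by a multiple of [|v - u|];
     Cauchy's estimate then gives the Lipschitz bound. *)
  pose q w := f (w + (v - u)) - f w.
  have dq w : normc (w - u) < 2 * r -> hasD q w (f1 (w + (v - u)) - f1 w).
    move=> wu; apply: hasDB; last by apply: df; have := tri w u z; lra.
    apply: hasD_shift; apply: df.
    have -> : w + (v - u) - z = (w - u) + (v - z) by ring.
    by have := le_normcD (w - u) (v - z); lra.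
  apply: (@cauchy_estimate q u (2 * r)).
  - by rewrite r0 ltr_pMl// ltr1n.
  - by move=> w /dq; eexists; eassumption.
  - have := dq u; rewrite subrr normc0 subrKC; apply.
    by rewrite mulr_gt0.
  - move=> w wu; rewrite /q.
    have -> : normc (v - u) = normc (w + (v - u) - w) by rewrite [w + _]addrC addrK.
    apply: fL; first by have := tri w u z; lra.
    have -> : w + (v - u) - z = (w - u) + (v - z) by ring.
    by have := le_normcD (w - u) (v - z); lra.
have f2 u h : normc (u - z) < 2 * r -> normc h < r ->
    normc (f (u + h) - f u - h * f1 u) <= M2 * normc h * normc h.
  move=> uz hr; pose q w := f w - f1 u * w.
  have -> : f (u + h) - f u - h * f1 u = q (u + h) - q u by rewrite /q; ring.
  have -> : M2 * normc h * normc h = (M2 * normc h) * normc (u + h - u).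
    by rewrite [u + h]addrC addrK.
  apply: mean_value_ineq => t t01; rewrite [u + h]addrC addrK.
  have th : normc (t%:C * h) <= normc h.
    rewrite normcM normcR; case/andP: t01 => t0 t1; rewrite ger0_norm//.
    by rewrite ler_piMl// normc_ge0.
  have vz : normc (u + t%:C * h - z) < 3 * r.
    have -> : u + t%:C * h - z = t%:C * h + (u - z) by ring.
    by have := le_normcD (t%:C * h) (u - z); lra.
  exists (f1 (u + t%:C * h) - f1 u * 1).
    by apply: hasDB; [apply: df; lra | apply: hasDZ; exact: hasD_id].
  rewrite mulr1; apply: le_trans (f1L u _ _ vz) _; first by lra.
  by rewrite [u + _]addrC addrK ler_wpM2l// !mulr_ge0// invr_ge0 ltW.
pose x := ln r; have xE : expR x = r by rewrite lnK.
have p0 := pi_gt0 R; have p0' := pi_ge0 R.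
have pC : (pi%:C : R[i]) != 0 by rewrite -normc_gt0 normcR gtr0_norm.
(* The value that Cauchy's formula would give for the derivative of [f1] at [z]. *)
pose m := cintegral 0 pi (fun s => symdq f1 z (circ x s)) * pi%:C^-1.
have M20 : 0 <= M2 by rewrite !mulr_ge0// invr_ge0 ltW.
(* As [f1] is not yet known to be differentiable, continuity comes from its Lipschitz bound. *)
have cf1 : ccont (fun s => symdq f1 z (circ x s)).
  apply: ccont_symdq => w wz e e0.
  exists (Num.min r (e / (1 + M2))); first by rewrite lt_min r0 divr_gt0//; lra.
  move=> v; rewrite lt_min => /andP[vr]; rewrite ltr_pdivlMr; last by lra.
  move=> ve.
  apply: le_lt_trans (f1L w v _ _) _; first by rewrite wz xE; lra.
    by have := tri v w z; rewrite wz xE; lra.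
  by have := normc_ge0 (v - w); nra.
have form u : normc (u - z) < r -> cintegral 0 pi (fun s => symdq f u (circ x s)) = f1 u * pi%:C.
  move=> uz; apply: (@cauchy_formula f u (2 * r)).
  - by rewrite xE ltr_pMl// ltr1n.
  - by move=> v vu; exists (f1 v); apply: df; have := tri v u z; lra.
  - by apply: df; lra.
have cf u : normc (u - z) < r -> ccont (fun s => symdq f u (circ x s)).
  move=> uz; apply: ccont_symdq => w wu; apply: hasD_continuous (df w _).
  by have := tri w u z; rewrite wu xE; lra.
exists m; apply/hasDP => e e0.
(* The integrand of the error has size at most [M2 |h|^2 / r], so the error is at most [k |h|^2];
   dividing [e] by [1 + k] also covers [k = 0]. *)
pose k := 2 * M2 / r.
have k0 : 0 <= k by rewrite !mulr_ge0// invr_ge0 ltW.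
exists (Num.min r (e / (1 + k))); first by rewrite lt_min r0 divr_gt0//; lra.
move=> w; rewrite lt_min => /andP[wr]; rewrite ltr_pdivlMr; last by lra.
move=> we; set h := w - z in wr we *.
have E : (f1 w - f1 z - m * h) * pi%:C =
    cintegral 0 pi (fun s => symdq f w (circ x s) - symdq f z (circ x s) - h * symdq f1 z (circ x s)).
  rewrite cintegralB; last 1 [exact: ccontZ] => //; last first.
    by apply: ccontB; apply: cf; rewrite ?subrr ?normc0.
  rewrite cintegralB; [|exact: cf|by apply: cf; rewrite subrr normc0].
  rewrite cintegralZ// !form ?subrr ?normc0// mulrBl [X in X - _]mulrBl /m; congr (_ - _).
  by rewrite mulrAC divfK// mulrC.
have : normc ((f1 w - f1 z - m * h) * pi%:C) <= 2 * (M2 * normc h * normc h / r) * (pi - 0).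
  rewrite E; apply: cintegral_bound => //.
    apply: ccontB; last exact: ccontZ.
    by apply: ccontB; apply: cf; rewrite ?subrr ?normc0.
  move=> s _; set c := circ x s.
  have nc : normc c = r by rewrite normc_circ.
  have -> : symdq f w c - symdq f z c - h * symdq f1 z c =
     ((f ((z + c) + h) - f (z + c) - h * f1 (z + c))
      - (f ((z - c) + h) - f (z - c) - h * f1 (z - c))) * (2 * c)^-1.
    rewrite /symdq.
    have -> : (z + c) + h = w + c by rewrite /h; ring.
    have -> : (z - c) + h = w - c by rewrite /h; ring.
    ring.
  rewrite normcM normcV normcM normc2 nc ler_pdivrMr ?mulr_gt0//.
  have -> : M2 * normc h * normc h / r * (2 * r) = M2 * normc h * normc h + M2 * normc h * normc h.
    by field; rewrite gt_eqF.
  apply: le_trans (le_normcD _ _) _; rewrite normcN; apply: lerD; apply: f2 => //.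
    by rewrite addrC addKr nc; lra.
  by rewrite addrC addKr normcN nc; lra.
rewrite normcM normcR subr0 gtr0_norm// ler_pM2r// => H.
apply: le_trans H _.
have -> : 2 * (M2 * normc h * normc h / r) = k * normc h * normc h by rewrite /k; ring.
have := normc_ge0 h; nra.
Qed.

End Cauchy.

(** * Slash operators and derivatives *)

Section ComplexPowers.
Variable R : realType.
Implicit Types (z w : R[i]) (s t : R).

Lemma is_derive_continuous_real (f : R -> R) (x l : R) : is_derive x 1 f l -> forall e, 0 < e ->
  exists2 d, 0 < d & forall y, `|y - x| < d -> `|f y - f x| < e.
Proof.
move=> /is_deriveP_real /(_ 1 ltr01)[d d0 Hd] e e0.
have L0 : 0 < 1 + `|l| + 1 by have := normr_ge0 l; lra.
exists (Num.min d (e / (1 + `|l| + 1))); first by rewrite lt_min d0 divr_gt0.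
move=> y; rewrite lt_min => /andP[yd]; rewrite ltr_pdivlMr// => ye.
have -> : f y - f x = (f y - f x - l * (y - x)) + l * (y - x) by rewrite subrK.
apply: le_lt_trans (ler_normD _ _) _; rewrite normrM.
have := Hd _ yd; move: ye.
have := normr_ge0 (y - x); have := normr_ge0 l; nra.
Qed.

Lemma sqr_normc_ReIm z : normc z ^+ 2 = complex.Re z ^+ 2 + complex.Im z ^+ 2.
Proof. by case: z => a b; rewrite /= sqr_sqrtr// addr_ge0 ?sqr_ge0. Qed.

Lemma Re_div_normc_bound z : z != 0 -> -1 <= complex.Re z / normc z <= 1.
Proof.
rewrite -normc_gt0 => n0.
by rewrite -ler_norml normrM normfV [`|normc z|]gtr0_norm// ler_pdivrMr// mul1r le_Re_normc.
Qed.

Lemma sin_acos_Re z : z != 0 ->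
  sin (acos (complex.Re z / normc z)) = `|complex.Im z| / normc z.
Proof.
move=> z0; rewrite sin_acos ?Re_div_normc_bound//; have n0 := z0; rewrite -normc_gt0 in n0.
have -> : 1 - (complex.Re z / normc z) ^+ 2 = (complex.Im z / normc z) ^+ 2.
  have E : complex.Im z ^+ 2 = normc z ^+ 2 - complex.Re z ^+ 2.
    by rewrite sqr_normc_ReIm addrC addKr.
  by rewrite !expr_div_n E; field; rewrite gt_eqF.
by rewrite sqrtr_sqr normrM normfV [`|normc z|]gtr0_norm.
Qed.

Lemma cexp_clog z : z != 0 -> cexp (clog z) = z.
Proof.
move=> z0; have n0 := z0; rewrite -normc_gt0 in n0.
have nN := lt0r_neq0 n0.
have b := Re_div_normc_bound z0.
have cE : cos (carg z) = complex.Re z / normc z.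
  by rewrite /carg; case: ifP => _; rewrite ?cosN acosK// in_itv.
have sE : sin (carg z) = complex.Im z / normc z.
  rewrite /carg; case: ifPn => h; rewrite ?sinN sin_acos_Re//.
    by rewrite ger0_norm.
  by rewrite ltr0_norm ?mulNr ?opprK// ltNge.
rewrite /cexp /clog /= lnK ?posrE// cE sE.
case: z {z0 n0 b cE sE} nN => a b nN; apply/eqP; rewrite eq_complex.
by apply/andP; split; apply/eqP; rewrite [LHS]/= mul0r ?subr0 ?addr0 mulrC divfK.
Qed.

(** Off the real axis [Re z / |z|] stays strictly between -1 and 1, where [acos] is differentiable,
    and the sign in [carg] is locally constant. *)
Lemma clog_continuous z : complex.Im z != 0 -> forall e, 0 < e ->
  exists2 d, 0 < d & forall w, normc (w - z) < d -> normc (clog w - clog z) < e.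
Proof.
move=> im0 e e0.
have z0 : z != 0 by apply: contra_neq im0 => ->.
have n0 := z0; rewrite -normc_gt0 in n0.
have e2 : 0 < e / 2 by rewrite divr_gt0.
have [d1 d10 H1] := is_derive_continuous_real (is_derive1_ln n0) e2.
have lt1 : -1 < complex.Re z / normc z < 1.
  have /andP[b1 b2] := Re_div_normc_bound z0.
  have : complex.Re z ^+ 2 < normc z ^+ 2.
    by rewrite sqr_normc_ReIm ltrDl exprn_even_gt0.
  move=> h; rewrite !lt_neqAle b1 b2 !andbT; apply/andP; split.
    apply/eqP => /(congr1 (fun x => x * normc z)); rewrite divfK ?gt_eqF// => E.
    by move: h; rewrite -E mulN1r sqrrN ltxx.
  apply/eqP => /(congr1 (fun x => x * normc z)); rewrite divfK ?gt_eqF// => E.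
  by move: h; rewrite E mul1r ltxx.
have [d2 d20 H2] := is_derive_continuous_real (is_derive1_acos lt1) e2.
(* The quotients [Re / normc] at [w] and [z] differ by at most [2 |w - z| / |z|], whence the 2; the
   last bound keeps [w] on the same side of the real axis as [z]. *)
pose d := Num.min (Num.min d1 (d2 * normc z / 2)) (`|complex.Im z|).
exists d.
  by rewrite /d !lt_min d10 normr_gt0 im0 !andbT /= divr_gt0// mulr_gt0.
move=> w; rewrite /d !lt_min => /andP[/andP[wd1 wd2] wim].
have wI : `|complex.Im w - complex.Im z| < `|complex.Im z|.
  by apply: le_lt_trans wim; rewrite -raddfB le_Im_normc.
have w0 : w != 0.
  by apply/eqP => E; move: wI; rewrite E /= sub0r normrN ltxx.
have nw : 0 < normc w by rewrite normc_gt0.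
have nwz : `|normc w - normc z| <= normc (w - z).
  have := normc_le_sub w z; have := normc_le_sub z w; rewrite (normcB z w).
  by rewrite ler_norml; lra.
have lnb : `|ln (normc w) - ln (normc z)| < e / 2.
  by apply: H1; exact: le_lt_trans wd1.
have acb : `|acos (complex.Re w / normc w) - acos (complex.Re z / normc z)| < e / 2.
  apply: H2; have -> : complex.Re w / normc w - complex.Re z / normc z =
      (complex.Re w * (normc z - normc w) + normc w * (complex.Re w - complex.Re z))
        / (normc w * normc z) by field; rewrite !gt_eqF.
  rewrite normrM normfV [`|normc w * _|]gtr0_norm ?mulr_gt0// ltr_pdivrMr ?mulr_gt0//.
  apply: le_lt_trans (ler_normD _ _) _; rewrite !normrM [`|normc w|]gtr0_norm// distrC.
  have r1 : `|complex.Re w - complex.Re z| <= normc (w - z) by rewrite -raddfB le_Re_normc.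
  have h1 : `|complex.Re w| * `|normc w - normc z| <= normc w * normc (w - z).
    by apply: ler_pM => //; exact: le_Re_normc.
  have h2 : normc w * `|complex.Re w - complex.Re z| <= normc w * normc (w - z).
    by rewrite ler_pM2l.
  have h3 : normc w * normc (w - z) < normc w * (d2 * normc z / 2) by rewrite ltr_pM2l.
  by lra.
have cb : `|carg w - carg z| < e / 2.
  rewrite /carg; move: wI; case: (lerP 0 (complex.Im z)) => iz; case: (lerP 0 (complex.Im w)) => iw.
  - by [].
  - by rewrite (ger0_norm iz) ltr_norml; lra.
  - by rewrite (ltr0_norm iz) ltr_norml; lra.
  - by rewrite -opprD normrN.
by apply: le_lt_trans (normc_le_ReIm _) _ => /=; lra.
Qed.

(** Inverse function rule: [clog] is a continuous right inverse of [cexp], whose derivative at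
    [clog z] is [z], which is not 0. *)
Lemma hasD_clog z : complex.Im z != 0 -> hasD (@clog R) z z^-1.
Proof.
move=> im0.
have z0 : z != 0 by apply: contra_neq im0 => ->.
have n0 := z0; rewrite -normc_gt0 in n0.
apply/hasDP => e e0.
(* The first bound yields [|z| |L| <= 2 |v|] for the increment [L] of the logarithm; the second
   turns the error [e' |L|] into [e |z| |v|]. *)
pose e' := Num.min (normc z / 2) (e * normc z ^+ 2 / 2).
have e'0 : 0 < e' by rewrite lt_min !divr_gt0// mulr_gt0// exprn_gt0.
have e'1 : e' <= normc z / 2 by rewrite /e' ge_min lexx.
have e'2 : e' <= e * normc z ^+ 2 / 2 by rewrite /e' ge_min lexx orbT.
have := hasD_cexp (clog z); rewrite cexp_clog// => /hasDP /(_ e' e'0)[d1 d10 H1].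
have [d2 d20 H2] := clog_continuous im0 d10.
exists (Num.min d2 (normc z)); first by rewrite lt_min d20.
move=> w; rewrite lt_min => /andP[/H2 /H1 + wz].
have w0 : w != 0.
  by apply/eqP => E; move: wz; rewrite E sub0r normcN ltxx.
rewrite !cexp_clog//; set L := clog w - clog z; set v := w - z => H.
have nL := normc_ge0 L; have nv := normc_ge0 v.
have h1 : normc z * normc L <= normc v + e' * normc L.
  rewrite -normcM; have -> : z * L = v - (v - z * L) by ring.
  by apply: le_trans (le_normcD _ _) _; rewrite normcN lerD2l.
have h2 : normc z * normc L <= 2 * normc v.
  have : e' * normc L <= normc z / 2 * normc L by rewrite ler_wpM2r.
  lra.
have -> : L - z^-1 * v = - (z^-1 * (v - z * L)) by field.
rewrite normcN normcM normcV -(ler_pM2l n0) mulrA divff ?gt_eqF// mul1r.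
apply: le_trans H _; rewrite -(ler_pM2l n0).
have : e' * (normc z * normc L) <= e * normc z ^+ 2 / 2 * (2 * normc v).
  by apply: ler_pM => //; [exact: ltW | rewrite mulr_ge0// ltW].
have -> : e * normc z ^+ 2 / 2 * (2 * normc v) = normc z * (normc z * (e * normc v)) by field.
by rewrite mulrCA.
Qed.

Lemma cpowD z s t : cpow z (s + t) = cpow z s * cpow z t.
Proof. by rewrite /cpow rmorphD /= mulrDl cexpD. Qed.

Lemma cpow_neq0 z s : cpow z s != 0.
Proof. exact: cexp_neq0. Qed.

Lemma cpowN z s : cpow z (- s) = (cpow z s)^-1.
Proof. by rewrite /cpow rmorphN /= mulNr cexpN. Qed.

Lemma cpow_nat z n : z != 0 -> cpow z n%:R = z ^+ n.
Proof.
move=> z0; elim: n => [|n IH]; first by rewrite /cpow mul0r cexp0 expr0.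
by rewrite -natr1 cpowD IH exprSr /cpow mul1r cexp_clog.
Qed.

Lemma hasD_cpow z s : complex.Im z != 0 -> hasD (fun w => cpow w s) z (s%:C / z * cpow z s).
Proof.
move=> im0; have := hasD_comp (hasDZ s%:C (hasD_clog im0)) (hasD_cexp _).
by move/hasD_eq; apply; rewrite mulrC.
Qed.

End ComplexPowers.

(** * Holomorphic functions on the upper half-plane and differentiation of the slash action *)

Section UpperHalfPlane.
Variable R : realType.
Local Notation H := (@upper_half_plane R).
Implicit Types (z l : R[i]) (f F : R[i] -> R[i]) (g : 'M[R]_2) (k w : R).

(** The constant [2 pi i], not a point of the half-plane: the ordinary derivative is [tau * D f]. *)
Definition tau : R[i] := 'i * (2 * pi)%:C.

Lemma uhp_near z : H z -> forall v, normc (v - z) < complex.Im z -> H v.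
Proof.
rewrite /upper_half_plane /= => z0 v; have := le_Im_normc (v - z).
by rewrite raddfB /= ler_norml => /andP[]; lra.
Qed.

Lemma holomorphicP f : holomorphic f <-> forall z, H z -> exists l, hasD f z l.
Proof.
split=> hf z Hz; first by exists ('D_1 (f : R[i]^o -> R[i]^o) z); apply/derivableP; exact: hf.
by have [l [+ _]] := hf z Hz.
Qed.

Lemma hasD_D f z l : hasD f z l -> D f z = tau^-1 * l.
Proof. by move=> [_ fl]; rewrite /D derive1E fl. Qed.

Lemma tau_neq0 : tau != 0.
Proof.
by rewrite -normc_gt0 normcM normcI mul1r normcR normr_gt0 mulf_neq0 ?pnatr_eq0// gt_eqF// pi_gt0.
Qed.

Lemma hasD_hol f z : holomorphic f -> H z -> hasD f z (tau * D f z).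
Proof.
move=> /holomorphicP hf /hf[l fl]; rewrite (hasD_D fl) mulrA divff ?tau_neq0// mul1r//.
Qed.

Lemma holomorphic_D f : holomorphic f -> holomorphic (D f).
Proof.
move=> hf; apply/holomorphicP => z Hz.
have [|l hl] := @hasD_derivative R f (fun v => tau * D f v) z (complex.Im z) Hz.
  by move=> v /(uhp_near Hz) Hv; exact: hasD_hol.
exists (tau^-1 * l); have := hasDZ tau^-1 hl.
by under eq_fun do rewrite mulrA mulVf ?tau_neq0// mul1r.
Qed.

Lemma holomorphic_iterD f n : holomorphic f -> holomorphic (iter n (@D R) f).
Proof. by move=> hf; elim: n => [|n IH]; [exact: hf | rewrite iterS; exact: holomorphic_D]. Qed.

Lemma hasD_uhp f F z l : H z -> (forall v, H v -> f v = F v) -> hasD f z l -> hasD F z l.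
Proof. by move=> Hz fF; apply: (hasD_near Hz) => v /(uhp_near Hz) /fF. Qed.

Lemma eq_holomorphic f F : (forall v, H v -> f v = F v) -> holomorphic f -> holomorphic F.
Proof.
move=> fF /holomorphicP hf; apply/holomorphicP => z Hz; have [l hl] := hf z Hz.
by exists l; exact: hasD_uhp fF hl.
Qed.

Lemma eq_D f F : (forall z, H z -> f z = F z) -> forall z, H z -> D f z = D F z.
Proof.
move=> fF z Hz.
have E : \forall v \near (z : R[i]^o), (f : R[i]^o -> R[i]^o) v = (F : R[i]^o -> R[i]^o) v.
  by apply/nbhs_normc; exists (complex.Im z); [exact: Hz | move=> v /(uhp_near Hz) /fF].
have := near_eq_derive (1 : R[i]^o) E.
by rewrite /D !derive1E => ->.
Qed.

Lemma eq_iterD n f F : (forall z, H z -> f z = F z) ->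
  forall z, H z -> iter n (@D R) f z = iter n (@D R) F z.
Proof.
by move=> fF; elim: n => [|n IH]; [exact: fF | rewrite !iterS; exact: eq_D].
Qed.

Lemma holomorphic_sum (I : Type) (r : seq I) (c : I -> R[i]) (f : I -> R[i] -> R[i]) :
  (forall i, holomorphic (f i)) -> holomorphic (fun z => \sum_(i <- r) c i * f i z).
Proof.
move=> hf; apply/holomorphicP => z Hz.
exists (\sum_(i <- r) c i * (tau * D (f i) z)).
by apply: hasD_sum => i; apply: hasDZ; exact: hasD_hol.
Qed.

Lemma D_sum (I : Type) (r : seq I) (c : I -> R[i]) (f : I -> R[i] -> R[i]) :
  (forall i, holomorphic (f i)) -> forall z, H z ->
  D (fun z => \sum_(i <- r) c i * f i z) z = \sum_(i <- r) c i * D (f i) z.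
Proof.
move=> hf z Hz; have : hasD (fun z => \sum_(i <- r) c i * f i z) z (\sum_(i <- r) c i * (tau * D (f i) z)).
  by apply: hasD_sum => i; apply: hasDZ; exact: hasD_hol.
move=> /hasD_D ->; rewrite mulr_sumr; apply: eq_bigr => i _.
by rewrite mulrCA [tau^-1 * _]mulrA mulVf ?tau_neq0// mul1r.
Qed.

Lemma iterD_sum (I : Type) (r : seq I) (c : I -> R[i]) (f : I -> R[i] -> R[i]) n :
  (forall i, holomorphic (f i)) -> forall z, H z ->
  iter n (@D R) (fun z => \sum_(i <- r) c i * f i z) z = \sum_(i <- r) c i * iter n (@D R) (f i) z.
Proof.
move=> hf; elim: n => [|n IH] z Hz; first by [].
rewrite iterS (eq_D IH Hz).
have hDf i : holomorphic (iter n (@D R) (f i)) := @holomorphic_iterD (f i) n (hf i).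
exact: (D_sum r c hDf Hz).
Qed.

Lemma det22 (A : 'M[R]_2) : \det A = A 0 0 * A 1 1 - A 0 1 * A 1 0.
Proof.
rewrite (expand_det_row _ 0) !big_ord_recl big_ord0 addr0 /cofactor !det_mx11 !mxE /=.
have -> : lift 0 0 = 1 :> 'I_2 by exact: val_inj.
have -> : lift 1 0 = 0 :> 'I_2 by exact: val_inj.
by rewrite expr0 expr1 mul1r mulN1r mulrN.
Qed.

Lemma autfactor_neq0 g z : SL2 g -> H z -> autfactor g z != 0.
Proof.
rewrite /SL2 /upper_half_plane /= det22 /autfactor => d1 z0; case: z z0 => a b /= b0.
rewrite eq_complex /= !(mul0r, subr0, addr0).
apply/negP => /andP[/eqP h1 /eqP h2].
have c0 : g 1 0 = 0.
  by move/eqP: h2; rewrite mulf_eq0 (gt_eqF b0) orbF => /eqP.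
by move: d1 h1; rewrite c0 !mul0r mulr0 subr0 add0r => + h; rewrite h mulr0 => /esym/eqP; rewrite oner_eq0.
Qed.

Lemma hasD_autfactor g z : hasD (autfactor g) z (g 1 0)%:C.
Proof.
have := hasDD (hasDZ (g 1 0)%:C (hasD_id z)) (hasD_cst (g 1 1)%:C z).
by rewrite mulr1 addr0.
Qed.

Lemma hasD_cpow_autfactor g z s : SL2 g -> H z ->
  hasD (fun v => cpow (autfactor g v) s) z
    (s%:C * (g 1 0)%:C / autfactor g z * cpow (autfactor g z) s).
Proof.
move=> sg Hz; have [c0|c0] := eqVneq (g 1 0) 0.
  rewrite c0 mulr0 !mul0r /autfactor c0.
  under eq_fun do rewrite mul0r add0r; exact: hasD_cst.
have im0 : complex.Im (autfactor g z) != 0.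
  move: Hz; rewrite /autfactor /upper_half_plane /=; case: z => a b /= b0.
  by rewrite !(mul0r, addr0) mulf_neq0// gt_eqF.
have := hasD_comp (hasD_autfactor g z) (hasD_cpow s im0); move/hasD_eq; apply.
ring.
Qed.

Lemma hasD_moebius g z : SL2 g -> H z -> hasD (moebius g) z ((autfactor g z) ^- 2).
Proof.
move=> sg Hz; have j0 := autfactor_neq0 sg Hz.
have h1 := hasDD (hasDZ (g 0 0)%:C (hasD_id z)) (hasD_cst (g 0 1)%:C z).
have := hasDM h1 (hasDV j0 (hasD_autfactor g z)); move/hasD_eq; apply.
have d1 : (g 0 0)%:C * (g 1 1)%:C - (g 0 1)%:C * (g 1 0)%:C = 1 :> R[i].
  by move: sg; rewrite /SL2 /= det22 -!rmorphM -rmorphB /= => ->.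
move: j0; rewrite /autfactor => j0.
rewrite mulr1 addr0.
transitivity (((g 0 0)%:C * (g 1 1)%:C - (g 0 1)%:C * (g 1 0)%:C) *
  ((g 1 0)%:C * z + (g 1 1)%:C) ^- 2); last by rewrite d1 mul1r.
field; exact: j0.
Qed.

Lemma moebius_uhp g z : SL2 g -> H z -> H (moebius g z).
Proof.
move=> sg Hz; have j0 := autfactor_neq0 sg Hz.
have n0 : 0 < normc (autfactor g z) by rewrite normc_gt0.
have n2 := sqr_normc_ReIm (autfactor g z).
move: sg Hz; rewrite /SL2 /upper_half_plane /= det22 => d1 Hz.
have -> : complex.Im (moebius g z) = complex.Im z / normc (autfactor g z) ^+ 2.
  rewrite n2; move: n2 n0; rewrite /moebius /autfactor; case: z {j0} Hz => a b /= b0.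
  rewrite !(mul0r, subr0, addr0) => n2 n0.
  set q := _ + _ ^+ 2.
  transitivity ((g 0 0 * g 1 1 - g 0 1 * g 1 0) * (b / q)); last by rewrite d1 mul1r.
  ring.
by rewrite divr_gt0// exprn_gt0.
Qed.

(** Minus the logarithmic derivative of the automorphy factor with respect to [D]: it measures how
    far [D] is from commuting with the slash action. *)
Definition eps g z : R[i] := - (tau^-1 * ((g 1 0)%:C / autfactor g z)).

Lemma cpowN2 g z w : SL2 g -> H z ->
  cpow (autfactor g z) (- (w + 2)) = cpow (autfactor g z) (- w) * (autfactor g z) ^- 2.
Proof.
move=> sg Hz; rewrite opprD cpowD; congr (_ * _).
by rewrite cpowN -(cpow_nat 2) ?autfactor_neq0.
Qed.

Lemma hasD_slash w g F z : SL2 g -> H z -> holomorphic F ->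
  hasD (slash w g F) z
    (tau * (slash (w + 2) g (D F) z + w%:C * eps g z * slash w g F z)).
Proof.
move=> sg Hz hF; have Hg := moebius_uhp sg Hz; have j0 := autfactor_neq0 sg Hz.
have h1 := hasD_comp (hasD_moebius sg Hz) (hasD_hol hF Hg).
have := hasDM (hasD_cpow_autfactor (- w) sg Hz) h1; move/hasD_eq; apply.
rewrite /slash cpowN2// /eps rmorphN /=.
have t0 := tau_neq0; move: tau t0 => t t0.
by field; rewrite t0 j0.
Qed.

Lemma holomorphic_slash w g F : SL2 g -> holomorphic F -> holomorphic (slash w g F).
Proof. by move=> sg hF; apply/holomorphicP => z Hz; eexists; exact: hasD_slash. Qed.

Lemma D_slash w g F z : SL2 g -> H z -> holomorphic F ->
  D (slash w g F) z = slash (w + 2) g (D F) z + w%:C * eps g z * slash w g F z.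
Proof.
by move=> sg Hz hF; rewrite (hasD_D (hasD_slash w sg Hz hF)) mulrA mulVf ?tau_neq0// mul1r.
Qed.

Lemma hasD_eps g z : SL2 g -> H z -> hasD (eps g) z (tau * eps g z ^+ 2).
Proof.
move=> sg Hz; have j0 := autfactor_neq0 sg Hz; have t0 := tau_neq0.
have h1 := hasDZ (- tau^-1 * (g 1 0)%:C) (hasDV j0 (hasD_autfactor g z)).
have E : eps g = (fun v => - tau^-1 * (g 1 0)%:C * (autfactor g v)^-1).
  by apply/funext => v; rewrite /eps; ring.
rewrite {1}E; move: h1 => /hasD_eq; apply; rewrite /eps.
by move: tau t0 => t t0; field; rewrite t0 j0.
Qed.

(** One step of the recursion for [D^n (F |_w g)]: the slash contributes the factor [w] and, because
    [D eps = eps^2], the power of [eps] contributes [p]. *)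
Lemma hasD_eps_slash p w g F z : SL2 g -> H z -> holomorphic F ->
  hasD (fun v => eps g v ^+ p * slash w g F v) z
    (tau * (eps g z ^+ p * slash (w + 2) g (D F) z +
            (w + p%:R)%:C * eps g z ^+ p.+1 * slash w g F z)).
Proof.
move=> sg Hz hF; have h1 := hasD_slash w sg Hz hF.
case: p => [|p].
  under eq_fun do rewrite expr0 mul1r.
  by move/hasD_eq: h1; apply; rewrite expr0 mul1r addr0 expr1.
have := hasDM (hasDX p (hasD_eps sg Hz)) h1; move/hasD_eq; apply.
rewrite rmorphD /= rmorph_nat !exprS; ring.
Qed.

End UpperHalfPlane.

(** * Rankin-Cohen brackets and the inversion formula *)

Section Combinatorics.
Variable R : realType.
Implicit Types (x k l X kappa : R) (n m i j p q s t : nat).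

Lemma pochhammer0 x : pochhammer x 0 = 1.
Proof. by rewrite /pochhammer big_ord0. Qed.

Lemma pochhammerSr x s : pochhammer x s.+1 = pochhammer x s * (x + s%:R).
Proof. by rewrite /pochhammer big_ord_recr. Qed.

Lemma pochhammerSl x s : pochhammer x s.+1 = x * pochhammer (x + 1) s.
Proof.
rewrite /pochhammer big_ord_recl addr0; congr (_ * _); apply: eq_bigr => i _.
by rewrite lift0 -addrA nat1r.
Qed.

Lemma pochhammerD x s t : pochhammer x (s + t) = pochhammer x s * pochhammer (x + s%:R) t.
Proof.
elim: t => [|t IH]; first by rewrite addn0 pochhammer0 mulr1.
by rewrite addnS !pochhammerSr IH natrD; ring.
Qed.

Lemma pochhammer_neq0 x s : (forall j, (j < s)%N -> x + j%:R != 0) -> pochhammer x s != 0.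
Proof. by move=> H; rewrite /pochhammer prodf_seq_neq0; apply/allP => j _ /=; apply: H. Qed.

Lemma gbinom_pochhammer x n : gbinom (n%:R + x - 1) n = pochhammer x n / n`!%:R.
Proof.
rewrite /gbinom /pochhammer; congr (_ / _).
rewrite (reindex_inj rev_ord_inj) /=; apply: eq_bigr => j _.
rewrite natrB//= -natr1; ring.
Qed.

Lemma fact_neq0 n : (n`!%:R : R) != 0.
Proof. by rewrite pnatr_eq0 -lt0n fact_gt0. Qed.

Lemma bin_factR n m : (m <= n)%N -> ('C(n, m))%:R = n`!%:R / (m`!%:R * (n - m)`!%:R) :> R.
Proof.
move=> mn; by rewrite -(bin_fact mn) !natrM mulfK// mulf_neq0 ?fact_neq0.
Qed.

(** Restricts a sum to the window that contains its support; the triangular double sums below are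
    handled this way. *)
Lemma sum_window (V : nmodType) (G : nat -> V) m p n : (p + n <= m)%N ->
  (forall i, (i < p)%N -> G i = 0) -> (forall i, (p + n < i <= m)%N -> G i = 0) ->
  \sum_(i < m.+1) G i = \sum_(u < n.+1) G (p + u)%N.
Proof.
move=> pnm G1 G2; rewrite -(big_mkord xpredT G) (@big_cat_nat _ _ _ p 0 m.+1)//=; last first.
  by rewrite (leq_trans (leq_addr n p))// leqW.
rewrite big_nat big1 ?add0r; last by move=> i /andP[_]; exact: G1.
rewrite (@big_cat_nat _ _ _ (p + n).+1 p m.+1)//=; last by rewrite leqW// leq_addr.
rewrite [X in _ + X]big_nat [X in _ + X]big1 ?addr0; last first.
  by move=> i /andP[h1 h2]; apply: G2; rewrite h1 -ltnS.
rewrite -{1}[p]add0n big_addn -addnS addKn big_mkord.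
by apply: eq_bigr => i _; rewrite addnC.
Qed.

Lemma alternating_bin n : (0 < n)%N -> \sum_(u < n.+1) (-1) ^+ u * ('C(n, u))%:R = 0 :> R.
Proof.
move=> n0; have := exprBn (1 : R) 1 n; rewrite subrr expr0n gtn_eqF// => E.
rewrite [RHS]E; apply: eq_bigr => i _.
by rewrite !expr1n !mulr1 mulr_natr.
Qed.

(* [D^n (f |_k g) = \sum_j Dslash_coef k n j * eps^(n - j) * (D^j f)|_(k + 2j) g]. *)
Definition Dslash_coef k n j : R := ('C(n, j))%:R * pochhammer (k + j%:R) (n - j).

Lemma Dslash_coef_small k n j : (n < j)%N -> Dslash_coef k n j = 0.
Proof. by move=> nj; rewrite /Dslash_coef bin_small// mul0r. Qed.

Lemma Dslash_coef0 k n : Dslash_coef k n.+1 0 = Dslash_coef k n 0 * (k + n%:R).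
Proof. by rewrite /Dslash_coef !bin0 !subn0 pochhammerSr addr0 mulrA. Qed.

(** The recursion that [hasD_eps_slash] imposes with [p = n - j] and [w = k + 2 j], so that
    [w + p = k + n + j]. After removal of the common Pochhammer factor it follows from Pascal's rule
    and [(j + 1) C(n, j + 1) = (n - j) C(n, j)]. *)
Lemma Dslash_coefS k n j : (j <= n)%N ->
  Dslash_coef k n.+1 j.+1 = Dslash_coef k n j.+1 * (k + n%:R + j.+1%:R) + Dslash_coef k n j.
Proof.
rewrite leq_eqVlt => /orP[/eqP ->|jn].
  by rewrite /Dslash_coef !binn !subnn bin_small// !mul0r add0r !pochhammer0.
rewrite /Dslash_coef subSS -(subnSK jn) (pochhammerSl (k + j%:R)) -[k + j%:R + 1]addrA natr1.
rewrite (pochhammerSr (k + j.+1%:R)); set P := pochhammer _ _.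
have E1 : (n - j.+1)%:R = n%:R - j.+1%:R :> R by rewrite natrB.
have E2 : j.+1%:R * ('C(n, j.+1))%:R = (n%:R - j%:R) * ('C(n, j))%:R :> R.
  by rewrite -natrM mul_bin_left natrM natrB// ltnW.
rewrite binS natrD E1; move: E2; rewrite -natr1.
move: ('C(n, j.+1))%:R ('C(n, j))%:R (n%:R : R) (j%:R : R) => b a N J E2.
apply/eqP; rewrite -subr_eq0; apply/eqP.
transitivity (P * ((N - J) * a - (J + 1) * b)); first by ring.
by rewrite E2 subrr mulr0.
Qed.

Definition rc_coef l k m i : R :=
  (-1) ^+ i * gbinom (m%:R + l - 1) (m - i) * gbinom (m%:R + k - 1) i.

Lemma rc_coefE l k m i : (i <= m)%N -> rc_coef l k m i =
  (-1) ^+ i * (pochhammer (l + i%:R) (m - i) / (m - i)`!%:R)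
            * (pochhammer (k + (m - i)%:R) i / i`!%:R).
Proof.
move=> im; rewrite /rc_coef; congr (_ * _ * _); rewrite -gbinom_pochhammer; congr gbinom.
  by rewrite natrB//; ring.
by rewrite natrB//; ring.
Qed.

(* The coefficient of [eps^(m - p - q) * (D^p h)| * (D^q f)|] in the bracket of
   two slashed functions. *)
Lemma rc_slash_coef l k m p q :
  \sum_(i < m.+1) rc_coef l k m i * Dslash_coef l i p * Dslash_coef k (m - i) q =
  if (p + q == m)%N then rc_coef l k m p else 0.
Proof.
pose G i := rc_coef l k m i * Dslash_coef l i p * Dslash_coef k (m - i) q.
have G1 i : (i < p)%N -> G i = 0 by move=> ip; rewrite /G Dslash_coef_small// mulr0 mul0r.
have G2 i : (i <= m)%N -> (m < i + q)%N -> G i = 0.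
  by move=> im iq; rewrite /G (@Dslash_coef_small k (m - i)) ?mulr0//; rewrite ltn_subLR.
rewrite -/(G _); have [mpq|pqm] := ltnP m (p + q).
  rewrite gtn_eqF// big1// => i _; have [/G1//|pi] := ltnP i p.
  by apply: G2; [rewrite -ltnS | rewrite (leq_trans mpq)// leq_add2r].
pose n := (m - (p + q))%N.
have mE : m = (p + n + q)%N by rewrite /n addnAC subnKC.
rewrite (@sum_window _ G m p n); [|by rewrite mE leq_addr|exact: G1|]; last first.
  by move=> i /andP[h1 h2]; apply: G2 => //; rewrite mE ltn_add2r.
(* The Pochhammer factors in [l], and likewise those in [k], join into products independent of [u].
   Only a signed binomial coefficient still depends on [u], and its sum is [(1 - 1)^n]. *)
have GE u : (u <= n)%N -> G (p + u)%N =
    (-1) ^+ p * (pochhammer (l + p%:R) (m - p) * pochhammer (k + q%:R) (m - q)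
      / (p`!%:R * q`!%:R * n`!%:R)) * ((-1) ^+ u * ('C(n, u))%:R).
  move=> un.
  have e1 : (m - (p + u) = (n - u) + q)%N by rewrite mE; lia.
  have e2 : (m - p = u + (m - (p + u)))%N by rewrite mE; lia.
  have e3 : (m - q = (n - u) + (p + u))%N by rewrite mE; lia.
  have e4 : (m - (p + u) - q = n - u)%N by rewrite e1 addnK.
  have c1 : pochhammer (l + p%:R) (m - p) =
      pochhammer (l + p%:R) u * pochhammer (l + (p + u)%:R) (m - (p + u)).
    by rewrite e2 pochhammerD natrD addrA.
  have c2 : pochhammer (k + q%:R) (m - q) =
      pochhammer (k + q%:R) (n - u) * pochhammer (k + (m - (p + u))%:R) (p + u).
    by rewrite e3 pochhammerD e1 natrD; congr (_ * pochhammer _ _); ring.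
  rewrite /G rc_coefE; last by rewrite mE; lia.
  rewrite c1 c2 /Dslash_coef addKn e4.
  rewrite (bin_factR (leq_addr u p)) addKn bin_factR; last by rewrite e1 leq_addl.
  rewrite e4 (bin_factR un) exprD.
  have f1 := fact_neq0 p; have f2 := fact_neq0 q; have f3 := fact_neq0 n.
  have f4 := fact_neq0 u; have f5 := fact_neq0 (n - u).
  have f6 := fact_neq0 (p + u); have f7 := fact_neq0 (m - (p + u)).
  by field; rewrite f1 f2 f3 f4 f5 f6 f7.
under eq_bigr => u _ do rewrite GE -1?ltnS//.
rewrite -mulr_sumr; case: ifP => [/eqP E|/negbT E].
  have n0 : n = 0%N by rewrite /n E subnn.
  rewrite n0 big_ord1 bin0 expr0 !mulr1 rc_coefE; last by rewrite -E leq_addr.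
  have -> : (m - p = q)%N by rewrite -E addKn.
  have -> : (m - q = p)%N by rewrite -E addnK.
  by field; rewrite !fact_neq0.
by rewrite alternating_bin ?mulr0// /n subn_gt0 ltn_neqAle E pqm.
Qed.

(** Over the common denominator this is a combination of [(U + 1) C(p + 1, U + 1) = (p + 1) C(p, U)]
    and Pascal's rule. *)
Lemma telescope_step X p U (d0 : forall j, (j <= p.+1)%N -> X - U.+1%:R - j%:R != 0) : (U < p)%N ->
  (-1) ^+ U.+1 * ('C(p.+1, U.+1))%:R * (X - 2 * U.+1%:R) / \prod_(j < p.+2) (X - U.+1%:R - j%:R)
  + (-1) ^+ U * ('C(p, U))%:R / \prod_(j < p.+1) (X - U%:R - j.+1%:R) =
  (-1) ^+ U.+1 * ('C(p, U.+1))%:R / \prod_(j < p.+1) (X - U.+1%:R - j.+1%:R).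
Proof.
move=> Up.
have -> : \prod_(j < p.+1) (X - U%:R - j.+1%:R) = \prod_(j < p.+1) (X - U.+1%:R - j%:R).
  by apply: eq_bigr => j _; rewrite -!natr1; ring.
have P1 : \prod_(j < p.+2) (X - U.+1%:R - j%:R) =
   (X - U.+1%:R) * \prod_(j < p.+1) (X - U.+1%:R - j.+1%:R).
  by rewrite big_ord_recl /= subr0; congr (_ * _); apply: eq_bigr => j _; rewrite /bump leq0n.
have P2 : \prod_(j < p.+2) (X - U.+1%:R - j%:R) =
   \prod_(j < p.+1) (X - U.+1%:R - j%:R) * (X - U.+1%:R - p.+1%:R).
  by rewrite big_ord_recr.
have n0 : \prod_(j < p.+2) (X - U.+1%:R - j%:R) != 0.
  by rewrite prodf_seq_neq0; apply/allP => j _ /=; apply: d0; rewrite -ltnS.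
move: P1 P2 n0.
set P := \prod_(j < p.+2) _; set B := \prod_(j < p.+1) (X - U.+1%:R - j.+1%:R).
set A := \prod_(j < p.+1) _.
move=> P1 P2 n0.
have A0 : A != 0 by apply: contraNneq n0 => E; rewrite P2 E mul0r.
have B0 : B != 0 by apply: contraNneq n0 => E; rewrite P1 E mulr0.
have iA : A^-1 = (X - U.+1%:R - p.+1%:R) / P.
  by apply: (mulfI A0); rewrite mulrA -P2 !divff.
have iB : B^-1 = (X - U.+1%:R) / P.
  by apply: (mulfI B0); rewrite mulrA [B * (_ - _)]mulrC -P1 !divff.
rewrite iA iB.
have E1 : U.+1%:R * ('C(p.+1, U.+1))%:R = p.+1%:R * ('C(p, U))%:R :> R.
  by rewrite -!natrM -(mul_bin_diag p.+1 U).
have E2 : ('C(p.+1, U.+1))%:R = ('C(p, U.+1))%:R + ('C(p, U))%:R :> R by rewrite binS natrD.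
rewrite exprS; move: E1 E2.
move: ('C(p.+1, U.+1))%:R ('C(p, U.+1))%:R ('C(p, U))%:R (p.+1%:R : R) (U.+1%:R : R) ((-1) ^+ U : R) (P^-1).
move=> a b c N V e Q E1 E2.
apply/eqP; rewrite -subr_eq0; apply/eqP.
transitivity (e * Q * ((V * a - N * c) - (X - V) * (a - (b + c)))); first by ring.
by rewrite E1 E2 !subrr !mulr0 subrr mulr0.
Qed.

Lemma telescope_sum X p U : (U <= p)%N ->
  (forall i, (i < 2 * p.+1)%N -> X - i%:R != 0) ->
  \sum_(u < U.+1) (-1) ^+ u * ('C(p.+1, u))%:R * (X - 2 * u%:R) / \prod_(j < p.+2) (X - u%:R - j%:R)
  = (-1) ^+ U * ('C(p, U))%:R / \prod_(j < p.+1) (X - U%:R - j.+1%:R).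
Proof.
move=> + X0; elim: U => [_|U IH Up].
  rewrite big_ord1 !bin0 expr0 !mul1r mulr0 !subr0 big_ord_recl /= subr0.
  have x0 : X != 0 by have := X0 0%N isT; rewrite subr0.
  rewrite invfM mulrA divff// mul1r; congr _^-1.
rewrite big_ord_recr /= IH 1?ltnW// addrC telescope_step// => j jp.
by rewrite -addrA -opprD -natrD X0//; lia.
Qed.

(** The closed form of the partial sum at [U = p] is the negative of the summand with [u = p + 1],
    in which [X - 2 (p + 1)] has been cancelled against the last factor of the product. *)
Lemma inversion_sum X p : (forall i, (i < 2 * p.+1)%N -> X - i%:R != 0) ->
  \sum_(u < p.+1) (-1) ^+ u * ('C(p.+1, u))%:R * (X - 2 * u%:R) / \prod_(j < p.+2) (X - u%:R - j%:R)
  + (-1) ^+ p.+1 / \prod_(j < p.+1) (X - p.+1%:R - j%:R) = 0.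
Proof.
move=> X0; rewrite telescope_sum// binn mulr1 exprS mulN1r mulNr.
apply/eqP; rewrite subr_eq0; apply/eqP; congr (_ / _).
by apply: eq_bigr => j _; rewrite -!natr1; ring.
Qed.

Lemma prod_falling X n : \prod_(j < n) (X - j%:R) = pochhammer (X - n%:R + 1) n.
Proof.
rewrite /pochhammer (reindex_inj rev_ord_inj) /=; apply: eq_bigr => j _.
by rewrite natrB// -natr1; ring.
Qed.

(** The coefficient of [D^s a_(m + s)] in [h_m], with [kappa] for [K]. *)
Definition h_coef kappa k m s : R :=
  ('C(m + s, s))%:R * pochhammer (k + m%:R) s / pochhammer (kappa - 2 * m%:R - s%:R - 1) s.

(* The coefficient of [D^(m - r) h_m * D^r f] in the [m]-th summand of the formula
   for [L f], with [kappa] for [K]. *)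
Definition a_coef kappa k m r : R :=
  (gbinom (kappa - m%:R - 1) m)^-1 * rc_coef (kappa - 2 * m%:R) k m (m - r).

(** Up to a factorial this is the Pochhammer product of length [m] starting at [kappa - 2 m], and
    all its factors are at least 1. *)
Lemma gbinom_neq0 kappa m : 2 * m%:R + 1 <= kappa -> gbinom (kappa - m%:R - 1) m != 0.
Proof.
move=> km; have -> : kappa - m%:R - 1 = m%:R + (kappa - 2 * m%:R) - 1 by ring.
rewrite gbinom_pochhammer mulf_neq0 ?invr_eq0 ?fact_neq0//.
apply: pochhammer_neq0 => j _; rewrite gt_eqF//.
by have := ler0n R j; lra.
Qed.

(** The Pochhammer product behind [gbinom] is cut after [u] factors; the remaining [r] factors
    cancel those in [rc_coef]. *)
Lemma a_coefE kappa k r u : 2 * (r + u)%:R + 1 <= kappa ->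
  a_coef kappa k (r + u) r = (-1) ^+ u * ((r + u)`!%:R / (r`!%:R * u`!%:R)) *
    pochhammer (k + r%:R) u / pochhammer (kappa - 2 * (r + u)%:R) u.
Proof.
set m := (r + u)%N => km; have mu : (m - u = r)%N by rewrite /m addnK.
have mr : (m - r = u)%N by rewrite /m addKn.
rewrite /a_coef mr rc_coefE ?mu; last by rewrite /m leq_addl.
have -> : kappa - m%:R - 1 = m%:R + (kappa - 2 * m%:R) - 1 by ring.
have -> : gbinom (m%:R + (kappa - 2 * m%:R) - 1) m =
    pochhammer (kappa - 2 * m%:R) u * pochhammer (kappa - 2 * m%:R + u%:R) r / m`!%:R.
  by rewrite gbinom_pochhammer -pochhammerD [(u + r)%N]addnC.
have p0 i j : pochhammer (kappa - 2 * m%:R + i%:R) j != 0.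
  apply: pochhammer_neq0 => l' _; rewrite gt_eqF//.
  by have := ler0n R l'; have := ler0n R i; lra.
have := p0 0%N u; rewrite addr0 => q0.
by field; rewrite q0 p0 !fact_neq0.
Qed.

(* The inversion is [inversion_sum] with [X = kappa - 2 r - 1]; when
   [kappa = 2 (r + p) + 1] the factor [X - 2 p] of the last term vanishes, which
   is why that term is kept apart there. *)
Lemma inversion_coef kappa k r p : 2 * (r + p)%:R + 1 <= kappa ->
  \sum_(u < p.+1) a_coef kappa k (r + u) r * h_coef kappa k (r + u) (p - u) = (p == 0%N)%:R.
Proof.
move=> kp; pose X := kappa - 2 * r%:R - 1.
pose c := (r + p)`!%:R / (r`!%:R * p`!%:R) * pochhammer (k + r%:R) p.
have le u : (u <= p)%N -> 2 * (r + u)%:R + 1 <= kappa.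
  move=> up; apply: le_trans kp; rewrite lerD2r ler_pM2l// ler_nat leq_add2l//.
have termE u : (u <= p)%N ->
    a_coef kappa k (r + u) r * h_coef kappa k (r + u) (p - u) =
    c * ((-1) ^+ u * ('C(p, u))%:R /
      (pochhammer (X - 2 * u%:R + 1) u * pochhammer (X - u%:R - p%:R) (p - u))).
  move=> up; rewrite a_coefE ?le// /h_coef.
  have ru : (r + u + (p - u) = r + p)%N by rewrite -addnA subnKC.
  rewrite ru bin_factR; last by rewrite -ru leq_addl.
  have -> : (r + p - (p - u) = r + u)%N by rewrite -ru addnK.
  have -> : kappa - 2 * (r + u)%:R = X - 2 * u%:R + 1 by rewrite /X natrD; ring.
  have -> : X - 2 * u%:R + 1 - (p - u)%:R - 1 = X - u%:R - p%:R by rewrite natrB//; ring.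
  have -> : k + (r + u)%:R = k + r%:R + u%:R by rewrite natrD addrA.
  rewrite /c (bin_factR up) -[in pochhammer _ p](subnKC up) pochhammerD.
  have p1 : pochhammer (X - 2 * u%:R + 1) u != 0.
    apply: pochhammer_neq0 => j _; rewrite gt_eqF// /X.
    by have := le u up; rewrite natrD; have := ler0n R j; lra.
  have p2 : pochhammer (X - u%:R - p%:R) (p - u) != 0.
    (* For [u = p] the starting point [X - 2 p] may be 0, but the product is then empty. *)
    case: (ltngtP u p) up => // [up _|-> _]; last by rewrite subnn pochhammer0 oner_eq0.
    apply: pochhammer_neq0 => j _; rewrite gt_eqF// /X.
    have : u%:R + 1 <= p%:R :> R by rewrite natr1 ler_nat.
    by move: kp; rewrite natrD; have := ler0n R j; lra.
  by field; rewrite p1 p2 !fact_neq0.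
under eq_bigr => u _ do rewrite termE -1?ltnS//.
rewrite -mulr_sumr; clear termE; case: p @c kp le => [|p] c kp le.
  rewrite big_ord1 !pochhammer0 bin0 expr0 !mulr1 invr1 mulr1 /c.
  by rewrite addn0 fact0 pochhammer0 !mulr1 divff ?fact_neq0.
rewrite big_ord_recr /= subnn pochhammer0 binn !mulr1.
rewrite [X in _ * X](_ : _ = 0) ?mulr0//.
have X0 i : (i < 2 * p.+1)%N -> X - i%:R != 0.
  move=> ip; rewrite gt_eqF// /X.
  have : i%:R + 1 <= 2 * p.+1%:R :> R by rewrite natr1 -natrM ler_nat.
  by move: kp; rewrite natrD; lra.
rewrite -[RHS](inversion_sum X0); congr (_ + _ / _); last first.
  by rewrite prod_falling; congr pochhammer; ring.
apply: eq_bigr => u _; have up : (u <= p)%N by rewrite -ltnS.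
(* The [p + 2] consecutive factors are cut at [X - 2 u]: those below and those above are the two
   Pochhammer products of [termE], and the middle one cancels the numerator. *)
have -> : \prod_(j < p.+2) (X - u%:R - j%:R) =
   pochhammer (X - u%:R - p.+1%:R) (p.+1 - u) * (X - 2 * u%:R) * pochhammer (X - 2 * u%:R + 1) u.
  rewrite prod_falling.
  have -> : X - u%:R - p.+2%:R + 1 = X - u%:R - p.+1%:R by rewrite (_ : p.+2%:R = p.+1%:R + 1) ?natr1//; ring.
  have {1}-> : (p.+2 = (p.+1 - u) + u.+1)%N by lia.
  rewrite (pochhammerD _ (p.+1 - u) u.+1) (pochhammerSl _ u) mulrA natrB ?leqW//.
  by congr (pochhammer _ _ * _ * pochhammer _ _); ring.
have x2 : X - 2 * u%:R != 0.
  by rewrite -natrM X0//; lia.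
rewrite -!mulrA; congr (_ * (_ * _)); rewrite !invfM [X in _ = _ * X]mulrCA mulrA.
by rewrite !mulrA divff// mul1r mulrC.
Qed.

End Combinatorics.

(** * Covariance of Rankin-Cohen brackets *)

Section RankinCohen.
Variable R : realType.
Local Notation H := (@upper_half_plane R).
Implicit Types (z : R[i]) (f h : R[i] -> R[i]) (g : 'M[R]_2) (k l : R) (n m : nat).

Lemma iterD_slash k g f n : SL2 g -> holomorphic f -> forall z, H z ->
  iter n (@D R) (slash k g f) z =
  \sum_(j < n.+1) (Dslash_coef k n j)%:C *
    (eps g z ^+ (n - j) * slash (k + 2 * j%:R) g (iter j (@D R) f) z).
Proof.
move=> sg hf; elim: n => [|n IH] z Hz.
  rewrite big_ord1 subnn expr0 !mul1r mulr0 addr0 /Dslash_coef bin0 subnn pochhammer0.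
  by rewrite mulr1 mul1r.
rewrite iterS (eq_D IH Hz).
pose phi j v := eps g v ^+ (n - j) * slash (k + 2 * j%:R) g (iter j (@D R) f) v.
have dphi j v : H v -> hasD (phi j) v _ := fun Hv =>
  hasD_eps_slash (n - j) (k + 2 * j%:R) sg Hv (@holomorphic_iterD R f j hf).
have hphi (j : 'I_n.+1) : holomorphic (phi j).
  by apply/holomorphicP => v Hv; eexists; exact: dphi.
rewrite (D_sum (index_enum 'I_n.+1) (fun j => (Dslash_coef k n j)%:C) hphi Hz).
pose X j := eps g z ^+ (n.+1 - j) * slash (k + 2 * j%:R) g (iter j (@D R) f) z.
have DE (j : 'I_n.+1) : D (phi j) z = X j.+1 + (k + n%:R + j%:R)%:C * X j.
  have jn : (j <= n)%N by rewrite -ltnS.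
  rewrite (hasD_D (dphi j z Hz)) mulrA mulVf ?tau_neq0// mul1r /X subSS subSn//.
  congr (_ + _).
    by rewrite iterS -[k + 2 * j%:R + 2]addrA -[X in 2 * _ + X]mulr1 -mulrDr natr1.
  by rewrite mulrA; congr (_%:C * _ * _); rewrite natrB//; ring.
under eq_bigr => j _ do rewrite DE mulrDr.
rewrite big_split [RHS]big_ord_recl -/(X 0%N).
under [X in _ = _ + X]eq_bigr => j _.
  rewrite lift0 -/(X j.+1) Dslash_coefS; last by rewrite -ltnS.
  rewrite rmorphD mulrDl; over.
rewrite big_split addrA [LHS]addrC; congr (_ + _).
clearbody X.
(* The coefficient at [j = n + 1] vanishes, so the sum may be lengthened to match the recursion. *)
transitivity (\sum_(j < n.+2) (Dslash_coef k n j * (k + n%:R + j%:R))%:C * X j).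
  rewrite [RHS]big_ord_recr /= Dslash_coef_small// mul0r rmorph0 mul0r addr0.
  by apply: eq_bigr => j _; rewrite [in RHS]rmorphM mulrA.
by rewrite big_ord_recl addr0 Dslash_coef0; congr (_ + _).
Qed.

(** A range independent of [n], obtained by adding terms with zero coefficient, allows the sums in
    the bracket to be exchanged. *)
Lemma iterD_slash_widen k g f n m : (n <= m)%N -> SL2 g -> holomorphic f -> forall z, H z ->
  iter n (@D R) (slash k g f) z =
  \sum_(j < m.+1) (Dslash_coef k n j)%:C *
    (eps g z ^+ (n - j) * slash (k + 2 * j%:R) g (iter j (@D R) f) z).
Proof.
move=> nm sg hf z Hz; rewrite iterD_slash//.
rewrite (big_ord_widen m.+1 (fun j => (Dslash_coef k n j)%:C *
    (eps g z ^+ (n - j) * slash (k + 2 * j%:R) g (iter j (@D R) f) z))) ?ltnS//.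
rewrite [RHS](bigID (fun j : 'I_m.+1 => (j < n.+1)%N)) /= [X in _ = _ + X]big1 ?addr0//.
by move=> j; rewrite -leqNgt => nj; rewrite Dslash_coef_small// mul0r.
Qed.

Lemma rankin_cohen_slash l k m g h f : SL2 g -> holomorphic h -> holomorphic f ->
  forall z, H z ->
  rankin_cohen l k m (slash l g h) (slash k g f) z =
  slash (l + k + 2 * m%:R) g (rankin_cohen l k m h f) z.
Proof.
move=> sg hh hf z Hz; rewrite /rankin_cohen.
pose A p := slash (l + 2 * p%:R) g (iter p (@D R) h) z.
pose B q := slash (k + 2 * q%:R) g (iter q (@D R) f) z.
(* The truncated exponent is correct whenever [p <= i] and [q <= m - i]; otherwise the coefficient
   is 0. *)
pose E p q : R[i] := eps g z ^+ (m - (p + q)) * (A p * B q).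
transitivity (\sum_(i < m.+1) \sum_(p < m.+1) \sum_(q < m.+1)
   (rc_coef l k m i * Dslash_coef l i p * Dslash_coef k (m - i) q)%:C * E p q).
  apply: eq_bigr => i _; have im : (i <= m)%N by rewrite -ltnS.
  rewrite (iterD_slash_widen l im sg hh Hz) (iterD_slash_widen k (leq_subr i m) sg hf Hz).
  rewrite -mulrA mulr_suml mulr_sumr; apply: eq_bigr => p _.
  rewrite mulr_sumr mulr_sumr; apply: eq_bigr => q _.
  have [pi|ip] := leqP p i; last by rewrite [Dslash_coef l _ _]Dslash_coef_small// !(mulr0, mul0r).
  have [qi|iq] := leqP q (m - i); last by rewrite [Dslash_coef k _ _]Dslash_coef_small// !(mulr0, mul0r).
  have -> : E p q = (eps g z ^+ (i - p) * A p) * (eps g z ^+ (m - i - q) * B q).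
    rewrite [RHS]mulrACA -exprD /E; congr (_ ^+ _ * _); lia.
  by rewrite -/(A p) -/(B q) /rc_coef !(rmorphM (real_complex R)) /=; ring.
(* With [i] innermost, [rc_slash_coef] leaves only [p + q = m], where no [eps] remains. *)
rewrite exchange_big; under eq_bigr => p _ do rewrite exchange_big.
under eq_bigr => p _.
  under eq_bigr => q _ do rewrite -mulr_suml -rmorph_sum /= rc_slash_coef.
  over.
rewrite /slash mulr_sumr; apply: eq_bigr => p _; have pm : (p <= m)%N by rewrite -ltnS.
have qm : (m - p < m.+1)%N by rewrite ltnS leq_subr.
rewrite (bigD1 (Ordinal qm)) //= subnKC// eqxx big1 ?addr0; last first.
  move=> q qp; rewrite ifN ?mul0r//; apply: contraNneq qp => E0.
  by apply/eqP/val_inj => /=; lia.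
rewrite /E subnKC// subnn expr0 mul1r /A /B /slash.
have -> : - (l + k + 2 * m%:R) = - (l + 2 * p%:R) + - (k + 2 * (m - p)%:R) :> R.
  by rewrite natrB//; ring.
rewrite cpowD /rc_coef; ring.
Qed.

End RankinCohen.

(** * Recovering the coefficients of the operator from the [h_m] *)

Section Inversion.
Variable R : realType.
Local Notation H := (@upper_half_plane R).
Implicit Types (z : R[i]) (f h : R[i] -> R[i]) (k : R) (K : int) (n m r s t : nat)
  (a : nat -> R[i] -> R[i]).

Lemma mldo_hE k K n a m z : mldo_h k K n a m z =
  \sum_(s < (n - m).+1) (h_coef K%:~R k m s)%:C * iter s (@D R) (a (m + s)%N) z.
Proof.
apply: eq_bigr => s _; congr (_%:C * _); rewrite /h_coef; congr (_ / pochhammer _ _).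
by rewrite -muln2 PoszM !rmorphB rmorphM /= mulrC.
Qed.

Lemma holomorphic_mldo_h k K n a m : (forall r, (r <= n)%N -> holomorphic (a r)) -> (m <= n)%N ->
  holomorphic (mldo_h k K n a m).
Proof.
move=> ha mn; pose F (s : 'I_(n - m).+1) := iter s (@D R) (a (m + s)%N).
have hF (s : 'I_(n - m).+1) : holomorphic (F s).
  by apply: holomorphic_iterD; apply: ha; have := ltn_ord s; lia.
have hS := @holomorphic_sum R _ (index_enum _) (fun s : 'I_(n - m).+1 => (h_coef K%:~R k m s)%:C) F hF.
by apply: (eq_holomorphic _ hS) => z _; rewrite mldo_hE.
Qed.

Lemma iterD_mldo_h k K n a m i : (forall r, (r <= n)%N -> holomorphic (a r)) -> (m <= n)%N ->
  forall z, H z -> iter i (@D R) (mldo_h k K n a m) z =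
  \sum_(s < (n - m).+1) (h_coef K%:~R k m s)%:C * iter (i + s) (@D R) (a (m + s)%N) z.
Proof.
move=> ha mn z Hz; pose F (s : 'I_(n - m).+1) := iter s (@D R) (a (m + s)%N).
have hF (s : 'I_(n - m).+1) : holomorphic (F s).
  by apply: holomorphic_iterD; apply: ha; have := ltn_ord s; lia.
rewrite (eq_iterD i (fun z _ => mldo_hE k K n a m z) Hz).
rewrite (iterD_sum (index_enum _) (fun s : 'I_(n - m).+1 => (h_coef K%:~R k m s)%:C) i hF Hz).
by apply: eq_bigr => s _; rewrite /F -iterD.
Qed.

(** Each [D^(m - r)] applied to [D^(t - m) a_t] gives [D^(t - r) a_t], whatever [m] is. Exchanging
    the sums therefore leaves a scalar sum over [m], which [inversion_coef] evaluates to a Kronecker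
    delta. *)
Lemma coefs_from_mldo_h k K n a r : n.*2%:Z < K -> (forall r, (r <= n)%N -> holomorphic (a r)) ->
  (r <= n)%N -> forall z, H z ->
  a r z = \sum_(m < n.+1 | (r <= m)%N)
    (a_coef K%:~R k m r)%:C * iter (m - r) (@D R) (mldo_h k K n a m) z.
Proof.
move=> nK ha rn z Hz.
pose T t := iter (t - r) (@D R) (a t) z.
pose c m t := if (r <= m <= t)%N then a_coef K%:~R k m r * h_coef K%:~R k m (t - m) else 0.
transitivity (\sum_(m < n.+1) \sum_(t < n.+1) (c m t)%:C * T t); last first.
  rewrite [RHS]big_mkcond; apply: eq_bigr => m _; have mn : (m <= n)%N by rewrite -ltnS.
  case: ifP => rm; last by rewrite big1// => t _; rewrite /c rm mul0r.
  rewrite iterD_mldo_h// mulr_sumr.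
  rewrite (@sum_window _ (fun t => (c m t)%:C * T t) n m (n - m)%N).
  - apply: eq_bigr => s _; rewrite /c rm leq_addr /T addKn rmorphM mulrA.
    by rewrite addnBAC.
  - by rewrite subnKC.
  - by move=> t tm; rewrite /c rm leqNgt tm mul0r.
  - by move=> t; rewrite subnKC// ltnNge => /andP[/negbTE ->].
rewrite exchange_big.
have sumE t : (t < n.+1)%N -> \sum_(m < n.+1) c m t = (t == r)%:R.
  rewrite ltnS => tn; have [rt|tr] := leqP r t; last first.
    rewrite big1 ?ltn_eqF// => m _; rewrite /c ifN//; lia.
  have -> : (t == r) = (t - r == 0)%N by lia.
  rewrite (@sum_window _ (fun m => c m t) n r (t - r)%N).
  - rewrite -(@inversion_coef R K%:~R k r (t - r)).
      apply: eq_bigr => u _; have := ltn_ord u; rewrite ltnS => ut.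
      rewrite /c leq_addr /= ifT; last by lia.
      by congr (_ * h_coef _ _ _ _); lia.
    (* The strict inequality between integers supplies the extra 1 in the bound on [kappa]. *)
    rewrite subnKC//; have h1 : (2 * t%:Z + 1 <= K) by move: nK; lia.
    by move: h1; rewrite -(ler_int R) rmorphD rmorphM /=.
  - by rewrite subnKC.
  - by move=> m mr; rewrite /c ifN//; lia.
  - by move=> m; rewrite subnKC// => h1; rewrite /c ifN//; lia.
under eq_bigr => t _ do rewrite -mulr_suml -rmorph_sum /= sumE//.
have rn1 : (r < n.+1)%N by rewrite ltnS.
rewrite (bigD1 (Ordinal rn1)) //= eqxx mul1r /T subnn big1 ?addr0//.
move=> t tr; rewrite (_ : (t == r :> nat) = false) ?mul0r//.
by apply: contraNF tr => /eqP E; apply/eqP/val_inj.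
Qed.

(** Each [a_r] is replaced by its expression in the [h_m] and the terms are grouped by [m]; the
    index of the bracket is [i = m - r]. *)
Lemma diffop_rankin_cohen k K n a : n.*2%:Z < K -> (forall r, (r <= n)%N -> holomorphic (a r)) ->
  forall f z, H z -> diffop n a f z =
  \sum_(m < n.+1) ((gbinom (K - m%:Z - 1)%:~R m)^-1)%:C
    * rankin_cohen (K - m.*2%:Z)%:~R k m (mldo_h k K n a m) f z.
Proof.
move=> nK ha f z Hz; rewrite /diffop.
pose E m r := (a_coef K%:~R k m r)%:C * iter (m - r) (@D R) (mldo_h k K n a m) z * iter r (@D R) f z.
transitivity (\sum_(r < n.+1) \sum_(m < n.+1) if (r <= m)%N then E m r else 0).
  apply: eq_bigr => r _; rewrite (coefs_from_mldo_h k nK ha _ Hz); last by rewrite -ltnS.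
  by rewrite mulr_suml big_mkcond.
rewrite exchange_big; apply: eq_bigr => m _; have mn : (m <= n)%N by rewrite -ltnS.
rewrite (@sum_window _ (fun r => if (r <= m)%N then E m r else 0) n 0 m)//; last first.
  by move=> r; rewrite add0n ltnNge => /andP[/negbTE ->].
rewrite (reindex_inj rev_ord_inj) /rankin_cohen mulr_sumr; apply: eq_bigr => i _.
have im : (i <= m)%N by rewrite -ltnS.
rewrite /= add0n subSS leq_subr /E subKn// /a_coef subKn// !mulrA; congr (_ * _ * _).
have -> : (K - m%:Z - 1)%:~R = K%:~R - m%:R - 1 :> R by rewrite !rmorphB.
have -> : (K - m.*2%:Z)%:~R = K%:~R - 2 * m%:R :> R.
  by rewrite -muln2 PoszM rmorphB rmorphM /= mulrC.
by rewrite !rmorphM /= !mulrA.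
Qed.

End Inversion.

(** * Cusps and covariance *)

Section Cusps.
Variable R : realType.
Local Notation H := (@upper_half_plane R).
Implicit Types (z : R[i]) (f F : R[i] -> R[i]) (g : 'M[R]_2) (w : R).

Lemma eq_bounded_at_infty f F : (forall z, H z -> f z = F z) ->
  bounded_at_infty f -> bounded_at_infty F.
Proof.
by move=> fF [Y [B HB]]; exists Y, B => z zY Hz; rewrite -fF//; exact: HB.
Qed.

Lemma bounded_at_inftyD f F : bounded_at_infty f -> bounded_at_infty F ->
  bounded_at_infty (fun z => f z + F z).
Proof.
move=> [Y [B HB]] [Y' [B' HB']]; exists (Num.max Y Y'), (B + B') => z.
rewrite gt_max => /andP[zY zY'] Hz; apply: le_trans (le_normcD _ _) _.
by apply: lerD; [exact: HB | exact: HB'].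
Qed.

Lemma bounded_at_inftyM f F : bounded_at_infty f -> bounded_at_infty F ->
  bounded_at_infty (fun z => f z * F z).
Proof.
move=> [Y [B HB]] [Y' [B' HB']]; exists (Num.max Y Y'), (B * B') => z.
rewrite gt_max => /andP[zY zY'] Hz; rewrite normcM.
by apply: ler_pM; rewrite ?normc_ge0//; [exact: HB | exact: HB'].
Qed.

Lemma bounded_at_infty_cst (c : R[i]) : bounded_at_infty (fun=> c).
Proof. by exists 0, (normc c). Qed.

Lemma bounded_at_infty_sum (I : Type) (r : seq I) (P : pred I) (f : I -> R[i] -> R[i]) :
  (forall i, P i -> bounded_at_infty (f i)) ->
  bounded_at_infty (fun z => \sum_(i <- r | P i) f i z).
Proof.
move=> hf; elim: r => [|i r IH].
  under eq_fun do rewrite big_nil; exact: bounded_at_infty_cst.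
under eq_fun do rewrite big_cons.
by case Pi : (P i); [apply: bounded_at_inftyD; [exact: hf | exact: IH] | exact: IH].
Qed.

Lemma bounded_at_infty_D f : holomorphic f -> bounded_at_infty f -> bounded_at_infty (D f).
Proof.
move=> hf [Y [B HB]].
(* Raising the height by 1 keeps the unit disc about [z] inside the half-plane and the circle of
   radius 1/2 inside the region where [f] is bounded. *)
exists (Num.max Y 0 + 1), (normc (tau R)^-1 * (2 * B / 2^-1)) => z zY Hz.
have zY1 : Y + 1 < complex.Im z.
  by apply: le_lt_trans zY; rewrite lerD2r le_max lexx.
have z1 : 1 < complex.Im z.
  by apply: le_lt_trans zY; rewrite lerDr le_max lexx orbT.
rewrite (hasD_D (hasD_hol hf Hz)) normcM ler_wpM2l ?normc_ge0//.
apply: (@cauchy_estimate R f z 1) => //.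
- by apply/andP; split; [rewrite invr_gt0 | rewrite invf_lt1 ?ltr1n].
- move=> v vz; exists (tau R * D f v); apply: hasD_hol => //.
  by apply: (uhp_near Hz); apply: lt_trans z1.
- exact: hasD_hol.
- move=> v vz; have := le_Im_normc (v - z); rewrite vz raddfB /= ler_norml => /andP[h1 _].
  have h2 : (2^-1 : R) < 1 by rewrite invf_lt1 ?ltr1n.
  by apply: HB; rewrite /upper_half_plane /=; lra.
Qed.

(** If [c] is not 0, then [|c z + d| >= |c| Im z], so [|c / (c z + d)| <= 1] above height 1. *)
Lemma bounded_at_infty_eps g : SL2 g -> bounded_at_infty (eps g).
Proof.
move=> sg; have [c0|c0] := eqVneq (g 1 0) 0.
  have -> : eps g = fun=> 0 by apply/funext => z; rewrite /eps c0 mul0r mulr0 oppr0.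
  exact: bounded_at_infty_cst.
exists 1, (normc (tau R)^-1) => z z1 Hz.
rewrite /eps normcN normcM ler_piMr ?normc_ge0// normcM normcV normcR.
rewrite ler_pdivrMr ?normc_gt0 ?autfactor_neq0// mul1r.
apply: le_trans (le_Im_normc _).
have -> : complex.Im (autfactor g z) = g 1 0 * complex.Im z.
  by rewrite /autfactor; case: z {z1 Hz} => x y /=; rewrite mul0r !addr0.
rewrite normrM ler_peMr// (le_trans _ (ler_norm _))// ltW//.
Qed.

Lemma bounded_slash_D w g F : SL2 g -> holomorphic F ->
  bounded_at_infty (slash w g F) -> bounded_at_infty (slash (w + 2) g (D F)).
Proof.
move=> sg hF bF.
apply: (@eq_bounded_at_infty
  (fun z => D (slash w g F) z + (- w%:C * eps g z) * slash w g F z)).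
  by move=> z Hz; rewrite D_slash//; ring.
apply: bounded_at_inftyD.
  by apply: bounded_at_infty_D; [exact: holomorphic_slash | exact: bF].
apply: bounded_at_inftyM; last exact: bF.
apply: bounded_at_inftyM; first exact: bounded_at_infty_cst.
exact: bounded_at_infty_eps.
Qed.

Lemma bounded_slash_iterD w g F n : SL2 g -> holomorphic F ->
  bounded_at_infty (slash w g F) -> bounded_at_infty (slash (w + 2 * n%:R) g (iter n (@D R) F)).
Proof.
move=> sg hF bF; elim: n => [|n IH]; first by rewrite mulr0 addr0.
have -> : w + 2 * n.+1%:R = w + 2 * n%:R + 2.
  by rewrite (_ : n.+1%:R = n%:R + 1) ?natr1//; ring.
by rewrite iterS; apply: bounded_slash_D; [exact: sg | exact: holomorphic_iterD | exact: IH].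
Qed.

Lemma holomorphic_at_cusps_iterD (G : set 'M[R]_2) (w w' : R) F n : w' = w + 2 * n%:R ->
  holomorphic F -> holomorphic_at_cusps G w F -> holomorphic_at_cusps G w' (iter n (@D R) F).
Proof.
move=> -> hF cF s [ss es]; apply: bounded_slash_iterD => //.
by apply: cF; split.
Qed.

Lemma holomorphic_at_cusps_sum (G : set 'M[R]_2) w F (I : Type) (r : seq I) (P : pred I)
    (c : I -> R[i]) (f : I -> R[i] -> R[i]) :
  (forall i, P i -> holomorphic_at_cusps G w (f i)) ->
  (forall z, H z -> F z = \sum_(i <- r | P i) c i * f i z) -> holomorphic_at_cusps G w F.
Proof.
move=> cf FE s cs; have ss : SL2 s by case: cs.
apply: (@eq_bounded_at_infty (fun z => \sum_(i <- r | P i) c i * slash w s (f i) z)).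
  move=> z Hz; rewrite /slash FE; last exact: moebius_uhp.
  by rewrite mulr_sumr; apply: eq_bigr => i _; rewrite mulrCA.
apply: bounded_at_infty_sum => i Pi; apply: bounded_at_inftyM; last exact: cf.
exact: bounded_at_infty_cst.
Qed.

Lemma weight_shift (K : int) (r s : nat) :
  (K - r.*2%:Z)%:~R = (K - (r + s).*2%:Z)%:~R + 2 * s%:R :> R.
Proof. by rewrite -!muln2 mulnDl PoszD !PoszM !rmorphB !rmorphD !rmorphM /=; ring. Qed.

Lemma cusps_mldo_h (G : set 'M[R]_2) k K n a :
  (forall r, (r <= n)%N -> holomorphic (a r)) ->
  (forall r, (r <= n)%N -> holomorphic_at_cusps G (K - r.*2%:Z)%:~R (a r)) ->
  forall m, (m <= n)%N -> holomorphic_at_cusps G (K - m.*2%:Z)%:~R (mldo_h k K n a m).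
Proof.
move=> ha ca m mn.
apply: (@holomorphic_at_cusps_sum _ _ _ _ (index_enum 'I_(n - m).+1) xpredT
   (fun s => (h_coef K%:~R k m s)%:C) (fun s => iter s (@D R) (a (m + s)%N))).
  move=> s _; have sn : (m + s <= n)%N by have := ltn_ord s; lia.
  by apply: (holomorphic_at_cusps_iterD (weight_shift K m s)); [exact: ha | exact: ca].
by move=> z _; rewrite mldo_hE.
Qed.

Lemma cusps_coefs (G : set 'M[R]_2) k K n a : n.*2%:Z < K ->
  (forall r, (r <= n)%N -> holomorphic (a r)) ->
  (forall m, (m <= n)%N -> holomorphic_at_cusps G (K - m.*2%:Z)%:~R (mldo_h k K n a m)) ->
  forall r, (r <= n)%N -> holomorphic_at_cusps G (K - r.*2%:Z)%:~R (a r).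
Proof.
move=> nK ha ch r rn.
apply: (@holomorphic_at_cusps_sum _ _ _ _ (index_enum 'I_n.+1) (fun m => (r <= m)%N)
   (fun m => (a_coef K%:~R k m r)%:C) (fun m => iter (m - r) (@D R) (mldo_h k K n a m))).
  move=> m rm; have mn : (m <= n)%N by rewrite -ltnS.
  have E := weight_shift K r (m - r); rewrite subnKC// in E.
  by apply: (holomorphic_at_cusps_iterD E); [exact: holomorphic_mldo_h | exact: ch].
by move=> z Hz; rewrite (coefs_from_mldo_h k nK ha rn Hz).
Qed.

End Cusps.

(** * Invariance of the operator against invariance of the [h_m] *)

Section Covariance.
Variable R : realType.
Local Notation H := (@upper_half_plane R).
Implicit Types (z : R[i]) (f h : R[i] -> R[i]) (g : 'M[R]_2) (k : R) (K : int) (n m : nat).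

Let bracket k K m h f z : R[i] := ((gbinom (K - m%:Z - 1)%:~R m)^-1)%:C
    * rankin_cohen (K - m.*2%:Z)%:~R k m h f z.

Lemma eq_rankin_cohen (l k : R) m h h' f z : H z -> (forall z, H z -> h z = h' z) ->
  rankin_cohen l k m h f z = rankin_cohen l k m h' f z.
Proof.
by move=> Hz hh; apply: eq_bigr => i _; rewrite (eq_iterD i hh Hz).
Qed.

(** The bracket formula at [g z] combined with covariance of each bracket. Invariance of the
    operator thus becomes a comparison of two sums of brackets that differ only in [h_m] and
    [h_m | g]. *)
Lemma slash_diffop k K n a g f z : n.*2%:Z < K ->
  (forall r, (r <= n)%N -> holomorphic (a r)) -> SL2 g -> holomorphic f -> H z ->
  slash (k + K%:~R) g (diffop n a f) z =
  \sum_(m < n.+1) bracket k K m (slash (K - m.*2%:Z)%:~R g (mldo_h k K n a m)) (slash k g f) z.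
Proof.
move=> nK ha sg hf Hz; rewrite {1}/slash (diffop_rankin_cohen k nK ha f (moebius_uhp sg Hz)).
rewrite mulr_sumr; apply: eq_bigr => m _; have mn : (m <= n)%N by rewrite -ltnS.
have hm : holomorphic (mldo_h k K n a m) by exact: holomorphic_mldo_h.
rewrite /bracket (rankin_cohen_slash _ _ m sg hm hf Hz) /slash mulrCA; congr (_ * (cpow _ (- _) * _)).
by rewrite -muln2 PoszM rmorphB rmorphM /=; ring.
Qed.

Lemma holomorphic_pow (c : R[i]) m : holomorphic (fun v => (v - c) ^+ m).
Proof.
apply/holomorphicP => v _; have h1 := hasDB (hasD_id v) (hasD_cst c v).
by case: m => [|m]; [exists 0; exact: hasD_cst | eexists; exact: hasDX h1].
Qed.

(* [f] vanishes to order exactly [m] at [g z], hence so does [f |_k g] at [z]. *)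
Lemma iterD_slash_pow k g m z : SL2 g -> H z ->
  let f := fun v => (v - moebius g z) ^+ m in
  (forall j, (j < m)%N -> iter j (@D R) (slash k g f) z = 0) /\
  iter m (@D R) (slash k g f) z != 0.
Proof.
move=> sg Hz f; pose v0 := moebius g z.
have Hv : H v0 := moebius_uhp sg Hz.
pose c j : R[i] := (tau R)^-1 ^+ j * (m ^_ j)%:R.
have iterE j v : H v -> (j <= m)%N -> iter j (@D R) f v = c j * (v - v0) ^+ (m - j).
  elim: j v => [|j IH] v Hv' jm; first by rewrite /c expr0 ffactn0 mul1r mul1r subn0.
  rewrite iterS (eq_D (F := fun v => c j * (v - v0) ^+ (m - j)) _ Hv'); last first.
    by move=> u Hu; rewrite IH// ltnW.
  have mj : (m - j = (m - j.+1).+1)%N by rewrite subnSK.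
  rewrite mj; have h1 := hasDB (hasD_id v) (hasD_cst v0 v).
  rewrite (hasD_D (hasDZ (c j) (hasDX (m - j.+1) h1))) /c subr0 mulr1 -mj ffactnSr natrM exprS.
  by ring.
have hf : holomorphic f := @holomorphic_pow v0 m.
have z0 j : (j < m)%N -> iter j (@D R) f v0 = 0.
  by move=> jm; rewrite iterE ?(ltnW jm)// subrr expr0n subn_eq0 leqNgt jm mulr0.
split=> [j jm|].
  rewrite iterD_slash// big1// => i _; rewrite /slash z0 ?mulr0//.
  by apply: leq_ltn_trans jm; rewrite -ltnS.
(* Only the term with all [m] derivatives on [f] survives; its coefficient is 1, and [D^m f] is the
   constant [m! / tau^m]. *)
rewrite iterD_slash// big_ord_recr big1 /= ?add0r; last first.
  by move=> i _; rewrite /slash z0 ?mulr0.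
rewrite subnn expr0 mul1r /slash iterE// subnn expr0 mulr1 /c.
rewrite /Dslash_coef binn subnn pochhammer0 mulr1 mul1r mulf_neq0// ?cpow_neq0//.
by rewrite mulf_neq0 ?expf_neq0 ?invr_neq0 ?tau_neq0// pnatr_eq0 -lt0n ffact_gt0.
Qed.

Lemma rankin_cohen_vanish (l k : R) m p h f z : (forall j, (j < p)%N -> iter j (@D R) f z = 0) ->
  (m < p)%N -> rankin_cohen l k m h f z = 0.
Proof.
move=> f0 mp; rewrite /rankin_cohen big1// => i _; rewrite f0 ?mulr0//.
exact: leq_ltn_trans (leq_subr _ _) mp.
Qed.

Lemma rankin_cohen_lead (l k : R) m h f z : (forall j, (j < m)%N -> iter j (@D R) f z = 0) ->
  rankin_cohen l k m h f z = (gbinom (m%:R + l - 1) m)%:C * h z * iter m (@D R) f z.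
Proof.
move=> f0; rewrite /rankin_cohen big_ord_recl big1 ?addr0; last first.
  by move=> i _; rewrite lift0 f0 ?mulr0// subnS prednK ?leq_subr// subn_gt0.
by rewrite /= subn0 expr0 mul1r [gbinom _ 0]/gbinom big_ord0 fact0 invr1 !mulr1.
Qed.

Lemma mldo_h_invariant k K n a g : n.*2%:Z < K ->
  (forall r, (r <= n)%N -> holomorphic (a r)) -> SL2 g ->
  (forall f, holomorphic f -> forall z, H z ->
     diffop n a (slash k g f) z = slash (k + K%:~R) g (diffop n a f) z) ->
  forall m, (m <= n)%N -> forall z, H z ->
    slash (K - m.*2%:Z)%:~R g (mldo_h k K n a m) z = mldo_h k K n a m z.
Proof.
move=> nK ha sg inv m mn.
(* Induction on [n - m], that is, descending in [m]. *)
have [d] := ubnP (n - m); elim: d m mn => // d IH m mn md z Hz.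
pose f v := (v - moebius g z) ^+ m; pose F := slash k g f.
have hf : holomorphic f := @holomorphic_pow (moebius g z) m.
have [F0 FN] := iterD_slash_pow k m sg Hz; rewrite -/f -/F in F0 FN.
have := inv f hf z Hz.
rewrite slash_diffop// (diffop_rankin_cohen k nK ha)// -/F.
have mn1 : (m < n.+1)%N by rewrite ltnS.
rewrite (bigD1 (Ordinal mn1)) //= [RHS](bigD1 (Ordinal mn1)) //=.
(* Brackets of order below [m] vanish at [z], because [F] vanishes there to order [m]; those of
   order above [m] agree by induction. *)
have -> : \sum_(i < n.+1 | i != Ordinal mn1)
     ((gbinom (K - i%:Z - 1)%:~R i)^-1)%:C * rankin_cohen (K - i.*2%:Z)%:~R k i (mldo_h k K n a i) F z =
   \sum_(i < n.+1 | i != Ordinal mn1)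
     bracket k K i (slash (K - i.*2%:Z)%:~R g (mldo_h k K n a i)) F z.
  apply: eq_bigr => i; rewrite -(inj_eq val_inj) /= neq_ltn => /orP[im|mi].
    by rewrite /bracket !(rankin_cohen_vanish _ _ _ F0 im).
  congr (_ * _); apply: eq_rankin_cohen => // v Hv.
  by rewrite IH//; have := ltn_ord i; lia.
move/addIr; rewrite /bracket !(rankin_cohen_lead _ _ _ F0).
have Km : 2 * m%:R + 1 <= K%:~R :> R.
  have h1 : (2 * m%:Z + 1 <= K) by move: nK; lia.
  by move: h1; rewrite -(ler_int R) rmorphD rmorphM /=.
have b0 := gbinom_neq0 Km.
have -> : (K - m%:Z - 1)%:~R = K%:~R - m%:R - 1 :> R by rewrite !rmorphB.
have -> : m%:R + (K - m.*2%:Z)%:~R - 1 = K%:~R - m%:R - 1 :> R.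
  by rewrite -muln2 PoszM rmorphB rmorphM /=; ring.
have bC : ((gbinom (K%:~R - m%:R - 1) m)%:C : R[i]) != 0.
  by rewrite -normc_gt0 normcR normr_gt0.
(* The leading coefficient of the bracket is the normalising binomial coefficient itself, so what
   remains is [h_m] or [h_m | g] times the nonzero number [D^m F z]. *)
rewrite rmorphV ?unitfE// !mulrA mulVf// !mul1r.
by move/(mulIf FN) => ->.
Qed.

Lemma diffop_invariant k K n a g : n.*2%:Z < K ->
  (forall r, (r <= n)%N -> holomorphic (a r)) -> SL2 g ->
  (forall m, (m <= n)%N -> forall z, H z ->
    slash (K - m.*2%:Z)%:~R g (mldo_h k K n a m) z = mldo_h k K n a m z) ->
  forall f, holomorphic f -> forall z, H z ->
     diffop n a (slash k g f) z = slash (k + K%:~R) g (diffop n a f) z.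
Proof.
move=> nK ha sg inv f hf z Hz.
rewrite slash_diffop// (diffop_rankin_cohen k nK ha)//.
apply: eq_bigr => m _; congr (_ * _); apply: eq_rankin_cohen => // v Hv.
by rewrite inv// -ltnS.
Qed.

End Covariance.

Theorem theorem6 (R : realType) (G : set 'M[R]_2) (k : R) (K : int) (n : nat)
    (a : nat -> R[i] -> R[i])
    (hG : lattice G) (hn : n.*2%:Z < K)
    (ha : forall r, (r <= n)%N -> holomorphic (a r)) :
  (mldo G k K n a <->
     forall m, (m <= n)%N ->
       modular_form G (K - m.*2%:Z)%:~R (mldo_h k K n a m))
  /\
  (mldo G k K n a ->
     forall f, holomorphic f -> forall z, upper_half_plane z ->
       diffop n a f z =
       \sum_(m < n.+1)
         ((gbinom (K - m%:Z - 1)%:~R m)^-1)%:C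
         * rankin_cohen (K - m.*2%:Z)%:~R k m (mldo_h k K n a m) f z).
Proof.
have GSL g : G g -> SL2 g by case: hG => -[+ _ _ _] _ _; apply.
split; last by move=> _ f _ z Hz; exact: diffop_rankin_cohen.
split=> [[_ ca inv] m mn|hh].
  split; first exact: holomorphic_mldo_h.
    move=> g Gg z Hz; apply: (mldo_h_invariant hn ha (GSL g Gg)) => // f hf v Hv.
    exact: inv.
  exact: cusps_mldo_h.
split=> //.
  by apply: (@cusps_coefs R G k K n a hn ha) => m mn; have [_ _ c] := hh m mn; exact: c.
move=> g f Gg hf z Hz; apply: (diffop_invariant hn ha (GSL g Gg)) => // m mn v Hv.
by have [_ + _] := hh m mn; apply.
Qed.
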